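(* Assume that for all integers $0\le M,N\le 2s$ there exist a non-trivial admissible solution $\{u_1,\dots,u_M\}$ of the homogeneous Bethe equations $E_-^M(u_i,\bar u_i)=0$ ($i=1,\dots,M$) and a non-trivial admissible solution $\{w_1,\dots,w_N\}$ of the homogeneous Bethe equations $E_+^N(w_i,\bar w_i)=0$ ($i=1,\dots,N$). Denote such solutions by $S_-^{M(h)}$ and $S_+^{*N(h)}$ respectively. Then for all integers $0\le M,N\le 2s$ the $q$-Racah polynomials $R_M(\theta^*_N)$ are given by $$R_M(\theta^*_N)=\mathcal N^*_N(\bar v)^{-1}\,\frac{\langle\Psi_+^N(\bar v,m_0)|\Psi_-^M(\bar u,m_0)\rangle}{\langle\Omega^+|\Psi_-^M(\bar u,m_0)\rangle}\,\frac{\langle\Omega^+|\Omega^+\rangle}{\langle\Psi_+^N(\bar v,m_0)|\Psi_+^N(\bar v,m_0)\rangle}$$ for $\bar u=S_-^{M(h)}$ and $\bar v=S_+^{*N(h)}$.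
   Context: **Setting.** $q\in\mathbb C^*$ is not a root of unity; $[X,Y]_q=qXY-q^{-1}YX$; $b(x)=x-x^{-1}$. $s\ge 0$ is an integer or half-integer. $\mathsf b,\mathsf c,\mathsf b^*,\mathsf c^*,\zeta\in\mathbb C^*$ are generic subject to $\mathsf b\mathsf c=\mathsf b^*\mathsf c^*$ (in particular all quantities below are well defined). Put $\theta_M=\mathsf b q^{2M}+\mathsf c q^{-2M}$, $\theta^*_N=\mathsf b^*q^{2N}+\mathsf c^*q^{-2N}$, $\rho=-\mathsf b\mathsf c(q^2-q^{-2})^2$, $\omega=(q-q^{-1})^2\big(\mathsf b\mathsf c(\zeta^2+\zeta^{-2})(q^{2s+1}+q^{-2s-1})-(\mathsf b q^{2s}+\mathsf c q^{-2s})(\mathsf b^*q^{2s}+\mathsf c^*q^{-2s})\big)$, $\eta=-\frac{(q^2-q^{-2})^2}{q+q^{-1}}\mathsf b\mathsf c\big((\mathsf b q^{2s}+\mathsf c q^{-2s})(\zeta^2+\zeta^{-2})-(\mathsf b^*q^{2s}+\mathsf c^*q^{-2s})(q^{2s+1}+q^{-2s-1})\big)$, and $\eta^*$ is obtained from $\eta$ by exchanging $(\mathsf b,\mathsf c)\leftrightarrow(\mathsf b^*,\mathsf c^* )$. $\mathcal V$ is a complex vector space of dimension $2s+1$, and $A,A^*\in\mathrm{End}(\mathcal V)$ (the images $\pi(\mathsf A),\pi(\mathsf A^* )$ of the generators of the Askey-Wilson algebra) are diagonalizable, multiplicity-free, act irreducibly on $\mathcal V$, have eigenvalues $\{\theta_M\}_{M=0}^{2s}$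 and $\{\theta^*_N\}_{N=0}^{2s}$ respectively, and satisfy the Askey-Wilson relations $[A,[A,A^*]_q]_{q^{-1}}=\rho A^*+\omega A+\eta I$, $[A^*,[A^*,A]_q]_{q^{-1}}=\rho A+\omega A^*+\eta^*I$. They form a Leonard pair: there are eigenbases $A|\theta_M\rangle=\theta_M|\theta_M\rangle$, $A^*|\theta^*_N\rangle=\theta^*_N|\theta^*_N\rangle$ ($0\le M,N\le 2s$) with $A^*|\theta_M\rangle=A^*_{M+1,M}|\theta_{M+1}\rangle+A^*_{M,M}|\theta_M\rangle+A^*_{M-1,M}|\theta_{M-1}\rangle$ and $A|\theta^*_N\rangle=A_{N+1,N}|\theta^*_{N+1}\rangle+A_{N,N}|\theta^*_N\rangle+A_{N-1,N}|\theta^*_{N-1}\rangle$, normalized so that $|\theta^*_0\rangle=\sum_M|\theta_M\rangle$ and $$A^*_{M,M-1}=q^{2-4s}\frac{(1-q^{2M})(\mathsf c-\mathsf b q^{2M+4s})(\mathsf b^*q^{2s-1}\zeta^{-2}+\mathsf b q^{2M-2})(\mathsf c q^{2s-1}\zeta^2+\mathsf c^*q^{2M-2})}{(\mathsf c-\mathsf b q^{4M-2})(\mathsf c-\mathsf b q^{4M})},$$ $$A^*_{M-1,M}=\frac{(1-q^{2M-4s-2})(\mathsf c-\mathsf b q^{2M-2})(\mathsf c+\mathsf b^*\zeta^{-2}q^{2M+2s-1})(\mathsf c^*+\mathsf b\zeta^2q^{2M+2s-1})}{(\mathsf c-\mathsf b q^{4M-4})(\mathsf c-\mathsf b q^{4M-2})},$$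 $A^*_{M,M}=\theta^*_0-A^*_{M,M+1}-A^*_{M,M-1}$, the coefficients $A_{N,N'}$ being obtained by $(\mathsf b,\mathsf c,\zeta,M)\leftrightarrow(\mathsf b^*,\mathsf c^*,\zeta^{-1},N)$. $\tilde{\mathcal V}$ is the dual space, $\langle\cdot|\cdot\rangle$ the pairing $\tilde{\mathcal V}\times\mathcal V\to\mathbb C$; $\langle\theta_M|,\langle\theta^*_N|\in\tilde{\mathcal V}$ are nonzero left eigenvectors, $\langle\theta_M|A=\theta_M\langle\theta_M|$, $\langle\theta^*_N|A^*=\theta^*_N\langle\theta^*_N|$. The reference states are $|\Omega^-\rangle=|\theta_0\rangle$, $|\Omega^+\rangle=|\theta^*_0\rangle$, $\langle\Omega^-|=\langle\theta_0|$, $\langle\Omega^+|=\langle\theta^*_0|$. **$q$-Racah polynomials.** $R_M(\theta^*_N)={}_4\phi_3\left[\begin{matrix}q^{-2M},\frac{\mathsf b}{\mathsf c}q^{2M},q^{-2N},\frac{\mathsf b^*}{\mathsf c^*}q^{2N}\\ -\frac{\mathsf b}{\mathsf c^*}q^{2s+1}\zeta^2,-\frac{\mathsf b^*}{\mathsf c}q^{2s+1}\zeta^{-2},q^{-4s}\end{matrix};q^2,q^2\right]$ (base $q^2$, argument $q^2$; a finite sum up to $\min(M,N)$). **Bethe states.** Fix $\chi\in\mathbb C^*$ and an integer $m_0$. Put $$\mathcal B(u)=\chi\,b(u^2)\Big(\rho^{-1}\big([A^*,A]_q+\tfrac{\omega}{q-q^{-1}}I\big)+\tfrac{qu^2+q^{-1}u^{-2}}{q^2-q^{-2}}I\Big).$$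 - $|\Psi_-^M(\bar u,m_0)\rangle=\mathscr B^-(u_1,m_0+2(M-1))\cdots\mathscr B^-(u_M,m_0)|\Omega^-\rangle$, where $\mathscr B^-(u,m)=\alpha^{-1}q^{m+2}u\,\mathcal B(u)$ with $(q^2-q^{-2})\chi^{-1}\alpha\,\mathsf b\,q^{-m_0}=-1$. - $|\Psi_+^N(\bar w,m_0)\rangle=\mathscr B^+(w_1,m_0+2(N-1))\cdots\mathscr B^+(w_N,m_0)|\Omega^+\rangle$, where $\mathscr B^+(u,m)=\alpha^{-1}q^{-m-2}u^{-1}\mathcal B(u)$ with $(q^2-q^{-2})\chi^{-1}\alpha\,\mathsf c^*q^{m_0}=1$. - $\langle\Psi_+^N(\bar y,m_0)|=\langle\Omega^+|\mathscr C^+(y_1,m_0+2)\cdots\mathscr C^+(y_N,m_0+2N)$, where $\mathscr C^+(v,m)=\beta^{-1}q^{m-2}v^{-1}\mathcal B(v)$ with $(q^2-q^{-2})\chi^{-1}\beta\,\mathsf b^*q^{-m_0+2}=1$. **Normalization.** $\mathcal N^*_N(\bar w)=\prod_{k=1}^N\big(-q^{-1}w_k^{-1}b(w_k^2)A_{k,k-1}\big)^{-1}$, $\mathcal N^*_0=1$. **Homogeneous Bethe equations.** $f(u,v)=\frac{b(qv/u)b(uv)}{b(v/u)b(quv)}$, $h(u,v)=\frac{b(q^2uv)b(qu/v)}{b(quv)b(u/v)}$. For $\epsilon=\pm1$, $$\Lambda_1^\epsilon(u)=\tfrac{q^{-2s-1}}{u^\epsilon}(q^{2s+1}u\zeta^{-1}-u^{-1}\zeta)(q^{2s+1}u\zeta-u^{-1}\zeta^{-1})(u\mathsf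 c^*q^{-2s}+u^{-1}\mathsf b q^{2s})\Big(u(\tfrac{\mathsf c}{\mathsf c^*})^{\frac{1-\epsilon}2}+u^{-1}(\tfrac{\mathsf b^*}{\mathsf b})^{\frac{1+\epsilon}2}\Big),$$ $$\Lambda_2^\epsilon(u)=\tfrac{(u^2-u^{-2})q^{-2s-1}}{u^\epsilon(qu^2-q^{-1}u^{-2})}(q^{2s-1}u^{-1}\zeta-u\zeta^{-1})(q^{2s-1}u^{-1}\zeta^{-1}-u\zeta)(q^2u\mathsf b q^{2s}+u^{-1}\mathsf c^*q^{-2s})\Big(q^2u(\tfrac{\mathsf b^*}{\mathsf b})^{\frac{1+\epsilon}2}+u^{-1}(\tfrac{\mathsf c}{\mathsf c^*})^{\frac{1-\epsilon}2}\Big),$$ $$E_\pm^M(u_i,\bar u_i)=-\frac{b(u_i^2)}{b(qu_i^2)}\prod_{j\ne i}f(u_i,u_j)\Lambda_1^\pm(u_i)+\prod_{j\neq i}h(u_i,u_j)\Lambda_2^\pm(u_i),\quad i=1,\dots,M,\ 1\le j\le M.$$ A solution is *non-trivial* if $u_i\ne0$ and $u_i^2\neq u_i^{-2}$ for all $i$, and *admissible* if $U_i\ne U_j$ for $i\neq j$, where $U_i=(qu_i^2+q^{-1}u_i^{-2})/(q+q^{-1})$; the equations are understood where defined ($b(qu_i^2)\ne0$). *)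

(* Defs.v *)
From HB Require Import structures.
From mathcomp Require Import all_boot all_order all_algebra.
From mathcomp Require Import reals complex.

Set Implicit Arguments.
Unset Strict Implicit.
Unset Printing Implicit Defensive.

Import GRing.Theory passmx.
Local Open Scope ring_scope.

(* The parameters (q, b, c, bs, cs, z) = (q, b, c, b^*, c^*, zeta) together with the natural number 2s;
   every exponent of q in the theory is an integer combination of 1 and 2s,
   so half-integer spins need no square roots. *)
Record params (F : fieldType) := Params {
  pq : F; pb : F; pc : F; pbs : F; pcs : F; pz : F; p2s : nat }.

(* exchange of (b, c) with (bs, cs) *)
Definition swapbc (F : fieldType) (P : params F) : params F :=
  Params (pq P) (pbs P) (pcs P) (pb P) (pc P) (pz P) (p2s P).

(* exchange of (b, c, zeta) with (bs, cs, zeta^-1) *)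
Definition dualp (F : fieldType) (P : params F) : params F :=
  Params (pq P) (pbs P) (pcs P) (pb P) (pc P) (pz P)^-1 (p2s P).

Section Scalars.
Variables (F : fieldType) (P : params F).
Local Notation q := (pq P).
Local Notation b := (pb P).
Local Notation c := (pc P).
Local Notation bs := (pbs P).
Local Notation cs := (pcs P).
Local Notation z := (pz P).
Local Notation s2 := ((p2s P)%:Z).

Definition theta (M : nat) : F :=
  b * q ^ (2 * M%:Z) + c * q ^ (- (2 * M%:Z)).

Definition rho : F := - (b * c) * (q ^+ 2 - q ^- 2) ^+ 2.

Definition omega : F :=
  (q - q^-1) ^+ 2 *
  (b * c * (z ^+ 2 + z ^- 2) * (q ^ (s2 + 1) + q ^ (- s2 - 1))
   - (b * q ^ s2 + c * q ^ (- s2)) * (bs * q ^ s2 + cs * q ^ (- s2))).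

Definition eta : F :=
  - ((q ^+ 2 - q ^- 2) ^+ 2 / (q + q^-1)) * (b * c) *
  ((b * q ^ s2 + c * q ^ (- s2)) * (z ^+ 2 + z ^- 2)
   - (bs * q ^ s2 + cs * q ^ (- s2)) * (q ^ (s2 + 1) + q ^ (- s2 - 1))).

(* A*_{M,M-1} *)
Definition coef_up (M : nat) : F :=
  q ^ (2 - 2 * s2) *
  ((1 - q ^ (2 * M%:Z)) * (c - b * q ^ (2 * M%:Z + 2 * s2))
   * (bs * q ^ (s2 - 1) * z ^- 2 + b * q ^ (2 * M%:Z - 2))
   * (c * q ^ (s2 - 1) * z ^+ 2 + cs * q ^ (2 * M%:Z - 2)))
  / ((c - b * q ^ (4 * M%:Z - 2)) * (c - b * q ^ (4 * M%:Z))).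

(* A*_{M-1,M} *)
Definition coef_down (M : nat) : F :=
  ((1 - q ^ (2 * M%:Z - 2 * s2 - 2)) * (c - b * q ^ (2 * M%:Z - 2))
   * (c + bs * z ^- 2 * q ^ (2 * M%:Z + s2 - 1))
   * (cs + b * z ^+ 2 * q ^ (2 * M%:Z + s2 - 1)))
  / ((c - b * q ^ (4 * M%:Z - 4)) * (c - b * q ^ (4 * M%:Z - 2))).

End Scalars.

(* theta*_N and eta*: exchange (b, c) with (bs, cs) *)
Definition theta_star (F : fieldType) (P : params F) := theta (swapbc P).
Definition eta_star (F : fieldType) (P : params F) := eta (swapbc P).

(* A*_{M,M}.  At M = 0 and M = 2s the terms coef_up 0 and coef_down (2s+1)
   vanish, because of their factors 1 - q^0. *)
Definition coef_diag (F : fieldType) (P : params F) (M : nat) : F :=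
  theta_star P 0 - coef_down P M.+1 - coef_up P M.

(* "Generic" parameters: q is not a root of unity, and the denominators of the
   structure constants (which also control the distinctness of the theta_M and
   of the theta*_N) and of the q-Racah polynomials do not vanish. *)
Definition generic (F : fieldType) (P : params F) : Prop :=
  [/\ [/\ pq P != 0, pb P != 0, pc P != 0, pbs P != 0 & pcs P != 0]
        /\ pz P != 0,
      forall k : nat, (0 < k)%N -> pq P ^+ k != 1,
      pb P * pc P = pbs P * pcs P,
      forall k : nat, (k <= 2 * p2s P)%N ->
        pc P != pb P * pq P ^+ (2 * k) /\ pcs P != pbs P * pq P ^+ (2 * k)
    & forall k : nat, (k < p2s P)%N ->
        1 + pb P / pcs P * pq P ^+ (p2s P + 1 + 2 * k) * pz P ^+ 2 != 0 /\
        1 + pbs P / pc P * pq P ^+ (p2s P + 1 + 2 * k) * pz P ^- 2 != 0].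

Section QRacah.
Variable F : fieldType.

Definition qpochhammer (a p : F) (k : nat) : F := \prod_(i < k) (1 - a * p ^+ i).

(* The 4phi3 basic hypergeometric series truncated after the term of index K. *)
Definition phi43 (a1 a2 a3 a4 d1 d2 d3 p x : F) (K : nat) : F :=
  \sum_(k < K.+1)
    (qpochhammer a1 p k * qpochhammer a2 p k
     * qpochhammer a3 p k * qpochhammer a4 p k)
    / (qpochhammer d1 p k * qpochhammer d2 p k
       * qpochhammer d3 p k * qpochhammer p p k) * x ^+ k.

(* R_M(theta*_N).  The numerators q^(-2M) and q^(-2N) kill every term of index
   larger than min(M, N), so that the truncated series is the whole series. *)
Definition qRacah (P : params F) (M N : nat) : F :=
  let q := pq P in let s2 := (p2s P)%:Z in
  phi43 (q ^ (- (2 * M%:Z))) (pb P / pc P * q ^ (2 * M%:Z))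
        (q ^ (- (2 * N%:Z))) (pbs P / pcs P * q ^ (2 * N%:Z))
        (- (pb P / pcs P * q ^ (s2 + 1) * pz P ^+ 2))
        (- (pbs P / pc P * q ^ (s2 + 1) * pz P ^- 2))
        (q ^ (- (2 * s2)))
        (q ^+ 2) (q ^+ 2) (minn M N).

End QRacah.

Section Operators.
Variables (F : fieldType) (V : vectType F).
Implicit Types (X Y : 'End(V)) (f : 'Hom(V, F^o)).

Definition qcomm (r : F) X Y : 'End(V) :=
  (r *: (X \o Y) - r^-1 *: (Y \o X))%VF.

Definition diagonalizable_end X : Prop :=
  exists2 e : seq V, basis_of fullv e &
    forall v, v \in e -> exists x : F, X v = x *: v.

Definition multiplicity_free X : Prop :=
  forall x, leigenvalue X x -> \dim (leigenspace X x) = 1%N.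

Definition spectrum_is X (n : nat) (lam : nat -> F) : Prop :=
  forall x, leigenvalue X x <-> exists2 i : nat, (i <= n)%N & x = lam i.

Definition act_irreducibly X Y : Prop :=
  forall U : {vspace V}, (X @: U <= U)%VS -> (Y @: U <= U)%VS ->
    U = 0%VS \/ U = fullv.

Definition askey_wilson_relations (P : params F) A As : Prop :=
  qcomm (pq P)^-1 A (qcomm (pq P) A As)
    = rho P *: As + omega P *: A + eta P *: \1%VF
  /\
  qcomm (pq P)^-1 As (qcomm (pq P) As A)
    = rho P *: A + omega P *: As + eta_star P *: \1%VF.

Definition eigenbasis X (n : nat) (lam : nat -> F) (e : n.+1.-tuple V) : Prop :=
  basis_of fullv e /\
  forall M : nat, (M <= n)%N -> X e`_M = lam M *: e`_M.

(* up M, diag M, down M are the (M, M-1), (M, M), (M-1, M) entries of X in the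
   basis e; here e_(n+1) = e_(-1) = 0. *)
Definition tridiagonal_action X (up diag down : nat -> F) (n : nat)
    (e : n.+1.-tuple V) : Prop :=
  forall M : nat, (M <= n)%N ->
    X e`_M = up M.+1 *: e`_M.+1 + diag M *: e`_M
             + (if M is k.+1 then down k.+1 *: e`_k else 0).

Definition pairing f (v : V) : F := f v.

End Operators.

Section Bethe.
Variables (F : fieldType) (P : params F).
Local Notation q := (pq P).
Local Notation b := (pb P).
Local Notation c := (pc P).
Local Notation bs := (pbs P).
Local Notation cs := (pcs P).
Local Notation z := (pz P).
Local Notation s2 := ((p2s P)%:Z).

Definition bfun (x : F) : F := x - x^-1.

Definition fBethe (u v : F) : F :=
  (bfun (q * v / u) * bfun (u * v)) / (bfun (v / u) * bfun (q * u * v)).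

Definition hBethe (u v : F) : F :=
  (bfun (q ^+ 2 * u * v) * bfun (q * u / v)) / (bfun (q * u * v) * bfun (u / v)).

(* The sign epsilon is encoded as a boolean, true for +1 and false for -1;
   with the coercion bool >-> nat, the exponents (1 + epsilon)/2 and
   (1 - epsilon)/2 are eps and ~~ eps. *)
Definition powsign (u : F) (eps : bool) : F := if eps then u else u^-1.

Definition Lambda1 (eps : bool) (u : F) : F :=
  q ^ (- s2 - 1) / powsign u eps
  * (q ^ (s2 + 1) * u * z^-1 - u^-1 * z)
  * (q ^ (s2 + 1) * u * z - u^-1 * z^-1)
  * (u * cs * q ^ (- s2) + u^-1 * b * q ^ s2)
  * (u * (c / cs) ^+ (~~ eps) + u^-1 * (bs / b) ^+ eps).

Definition Lambda2 (eps : bool) (u : F) : F :=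
  ((u ^+ 2 - u ^- 2) * q ^ (- s2 - 1))
  / (powsign u eps * (q * u ^+ 2 - q^-1 * u ^- 2))
  * (q ^ (s2 - 1) * u^-1 * z - u * z^-1)
  * (q ^ (s2 - 1) * u^-1 * z^-1 - u * z)
  * (q ^+ 2 * u * b * q ^ s2 + u^-1 * cs * q ^ (- s2))
  * (q ^+ 2 * u * (bs / b) ^+ eps + u^-1 * (c / cs) ^+ (~~ eps)).

Definition EBethe (eps : bool) (M : nat) (u : M.-tuple F) (i : 'I_M) : F :=
  let ui := tnth u i in
  - (bfun (ui ^+ 2) / bfun (q * ui ^+ 2))
    * (\prod_(j < M | j != i) fBethe ui (tnth u j)) * Lambda1 eps ui
  + (\prod_(j < M | j != i) hBethe ui (tnth u j)) * Lambda2 eps ui.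

Definition USym (u : F) : F := (q * u ^+ 2 + q^-1 * u ^- 2) / (q + q^-1).

Definition nontrivial (M : nat) (u : M.-tuple F) : Prop :=
  forall i, tnth u i != 0 /\ tnth u i ^+ 2 != tnth u i ^- 2.

Definition admissible (M : nat) (u : M.-tuple F) : Prop :=
  forall i j, i != j -> USym (tnth u i) != USym (tnth u j).

(* Admissibility makes the denominators of f and h nonzero; the third clause
   makes the remaining ones, b(q u_i^2), nonzero. *)
Definition bethe_solution (eps : bool) (M : nat) (u : M.-tuple F) : Prop :=
  [/\ nontrivial u, admissible u,
      forall i, bfun (q * tnth u i ^+ 2) != 0
    & forall i, EBethe eps u i = 0].

Variables (V : vectType F) (A As : 'End(V)) (chi : F) (m0 : int).

Definition calB (u : F) : 'End(V) :=
  (chi * bfun (u ^+ 2)) *: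
  ((rho P)^-1 *: (qcomm q As A + (omega P / (q - q^-1)) *: \1%VF)
   + ((q * u ^+ 2 + q^-1 * u ^- 2) / (q ^+ 2 - q ^- 2)) *: \1%VF).

Definition Bminus (alpha u : F) (m : int) : 'End(V) :=
  (alpha^-1 * q ^ (m + 2) * u) *: calB u.

Definition Bplus (alpha u : F) (m : int) : 'End(V) :=
  (alpha^-1 * q ^ (- m - 2) * u^-1) *: calB u.

Definition Cplus (beta v : F) (m : int) : 'End(V) :=
  (beta^-1 * q ^ (m - 2) * v^-1) *: calB v.

(* The index i < M of a tuple stands for the index i + 1 of u_1, ..., u_M;
   the leftmost factor of an iterated composition is the one of index 0. *)
Definition Psi_minus (alpha : F) (M : nat) (u : M.-tuple F) (Om : V) : V :=
  (\big[@comp_lfun F V V V / \1%VF]_(i < M)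
      Bminus alpha (tnth u i) (m0 + 2 * (M%:Z - 1 - i%:Z))) Om.

Definition Psi_plus (alpha : F) (N : nat) (w : N.-tuple F) (Om : V) : V :=
  (\big[@comp_lfun F V V V / \1%VF]_(i < N)
      Bplus alpha (tnth w i) (m0 + 2 * (N%:Z - 1 - i%:Z))) Om.

Definition Psi_plus_left (beta : F) (N : nat) (y : N.-tuple F)
    (Om : 'Hom(V, F^o)) : 'Hom(V, F^o) :=
  (Om \o \big[@comp_lfun F V V V / \1%VF]_(i < N)
           Cplus beta (tnth y i) (m0 + 2 * (i%:Z + 1)))%VF.

(* Here coef_up (dualp P) k.+1 is A_{k+1,k}. *)
Definition norm_star (N : nat) (w : N.-tuple F) : F :=
  \prod_(k < N)
    (- (q^-1 * (tnth w k)^-1 * bfun (tnth w k ^+ 2) * coef_up (dualp P) k.+1))^-1.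

End Bethe.

(* Main.v *)
(* Put T = rho^-1 ([A*,A]_q + omega/(q - q^-1)).  Every B(u) is a scalar multiple of T - x(u), with
   x(u) = - (q u^2 + q^-1 u^-2)/(q^2 - q^-2), so a Bethe state is p(T) applied to a reference state,
   where p has the roots x(u_i).  The Askey-Wilson relations express A T^2 through T A T, T^2 A, A,
   T and 1; hence A p(T)|theta_0> = (D p)(T)|theta_0> for a second-order q-difference operator D
   with D x^M = theta_M x^M + lower terms.  If deg p = M, then D p - theta_M p has degree < M, and the
   Bethe equations say exactly that it vanishes at the M distinct roots of p.  Thus
   p(T)|theta_0> is a multiple of |theta_M>.  The epsilon = + case is the epsilon = - case for A and
   A* exchanged, T replaced by -T, u by u^-1, and (q, b, c, b*, c*, zeta) by
   (q^-1, c*, b*, c, b, zeta^-1).  Since T is tridiagonal and the Bethe operators commute, the bra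
   is a multiple of the coordinate form of |theta*_N>, and the ratio of scalar products is the ratio
   of the coordinates N and 0 of |theta_M> in the basis |theta*_N>.  These coordinates satisfy the
   three-term recurrence of the q-Racah polynomials. *)

Require Import Defs.
From HB Require Import structures.
From mathcomp Require Import all_boot all_order all_algebra.
From mathcomp Require Import reals complex ring zify.

Set Implicit Arguments.
Unset Strict Implicit.
Unset Printing Implicit Defensive.

Import GRing.Theory.
Local Open Scope ring_scope.

(** * Linear extension from monomials to polynomials *)

Section LinearExtension.
Variables (F : fieldType).

(** The linear map that sends the i-th monomial to [f i]. It serves twice: with values in [V] it
    gives p(T) v, and with values in [{poly F}] it gives the q-difference operator D. *)
Definition lext (W : lmodType F) (f : nat -> W) (p : {poly F}) : W :=
  \sum_(i < size p) p`_i *: f i.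

Lemma lext_widen (W : lmodType F) (f : nat -> W) (p : {poly F}) n :
  (size p <= n)%N -> lext f p = \sum_(i < n) p`_i *: f i.
Proof.
move=> le_pn; rewrite /lext (big_ord_widen n (fun i => p`_i *: f i)) //.
rewrite big_mkcond; apply: eq_bigr => i _; case: ltnP => // le_pi.
by rewrite nth_default // scale0r.
Qed.

Lemma lext_is_linear (W : lmodType F) (f : nat -> W) : linear (lext f).
Proof.
move=> a p r; pose n := maxn (size (a *: p + r)) (maxn (size p) (size r)).
rewrite !(@lext_widen _ _ _ n) ?leq_max ?leqnn ?orbT //.
rewrite scaler_sumr -big_split; apply: eq_bigr => i _ /=.
by rewrite coefD coefZ scalerDl scalerA.
Qed.

HB.instance Definition _ (W : lmodType F) (f : nat -> W) :=
  GRing.isLinear.Build F {poly F} W *:%R (lext f) (lext_is_linear f).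

Lemma eq_lext (W : lmodType F) (f g : nat -> W) : f =1 g -> lext f =1 lext g.
Proof. by move=> fg p; apply: eq_bigr => i _; rewrite fg. Qed.

Lemma lextC (W : lmodType F) (f : nat -> W) a : lext f a%:P = a *: f 0%N.
Proof. by rewrite (lext_widen _ (size_polyC_leq1 a)) big_ord1 coefC eqxx. Qed.

Lemma lextMX (W : lmodType F) (f : nat -> W) p :
  lext f (p * 'X) = lext (fun i => f i.+1) p.
Proof.
rewrite (@lext_widen _ _ _ (size p).+1); last first.
  by rewrite (leq_trans (size_polyMleq _ _)) // size_polyX addn2.
rewrite big_ord_recl coefMX eqxx scale0r add0r; apply: eq_bigr => i _.
by rewrite coefMX.
Qed.

Lemma lext_comp (W W' : lmodType F) (phi : {linear W -> W'}) (f : nat -> W) p :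
  phi (lext f p) = lext (phi \o f) p.
Proof. by rewrite linear_sum; apply: eq_bigr => i _; rewrite linearZ. Qed.

Lemma scalar_sum (W : lmodType F) (phi : W -> F) n (a : 'I_n -> F) (f : 'I_n -> W) :
  scalar phi -> phi (\sum_(i < n) a i *: f i) = \sum_(i < n) a i * phi (f i).
Proof.
move=> phi_lin; have phi0 : phi 0 = 0.
  by move: (phi_lin (-1) 0 0); rewrite scaler0 addr0 mulN1r addNr.
rewrite (big_morph phi (id1 := 0) (op1 := +%R)) // => [|x y].
  by apply: eq_bigr => i _; rewrite -[_ *: _]addr0 phi_lin phi0 addr0.
by rewrite -[x]scale1r phi_lin mul1r scale1r.
Qed.

Lemma scalar_lext (W : lmodType F) (phi : W -> F) (f : nat -> W) p :
  scalar phi -> phi (lext f p) = \sum_(i < size p) p`_i * phi (f i).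
Proof. exact: scalar_sum. Qed.

Lemma scalar_lext_monic (W : lmodType F) (phi : W -> F) (f : nat -> W) p n :
  scalar phi -> p \is monic -> size p = n.+1 ->
  (forall i, (i < n)%N -> phi (f i) = 0) -> phi (lext f p) = phi (f n).
Proof.
move=> phi_lin /eqP + size_p f0; rewrite lead_coefE scalar_lext // size_p /= => p_n.
rewrite big_ord_recr /= p_n mul1r big1 ?add0r // => i _.
by rewrite f0 // mulr0.
Qed.

End LinearExtension.

(** * Polynomials in an endomorphism, applied to a vector *)

Section PolyAct.
Variables (F : fieldType) (V : vectType F).
Implicit Types (T : 'End(V)) (p : {poly F}) (v : V).

Definition poly_act T p v : V := lext (fun i => iter i T v) p.

Lemma poly_actE T v : poly_act T ^~ v =1 lext (fun i => iter i T v).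
Proof. by []. Qed.

Lemma poly_actMX T p v : poly_act T (p * 'X) v = T (poly_act T p v).
Proof. by rewrite /poly_act lextMX lext_comp. Qed.

Lemma poly_actM T p r v : poly_act T (p * r) v = poly_act T p (poly_act T r v).
Proof.
elim/poly_ind: p => [|p a IHp]; first by rewrite mul0r {1 2}/poly_act !linear0.
rewrite mulrDl {1 2}/poly_act !linearD /= -!poly_actE mulrAC !poly_actMX IHp.
by congr (_ + _); rewrite mul_polyC {1 2}/poly_act linearZ lextC.
Qed.

Lemma poly_act1 T v : poly_act T 1 v = v.
Proof. by rewrite /poly_act lextC scale1r. Qed.

Lemma poly_act_XsubC T a p v :
  poly_act T (('X - a%:P) * p) v = (T - a *: \1%VF)%VF (poly_act T p v).
Proof.
rewrite mulrBl {1}/poly_act linearB /= -!poly_actE -commr_polyX poly_actMX.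
rewrite mul_polyC {2}/poly_act linearZ /= -poly_actE.
by rewrite add_lfunE opp_lfunE scale_lfunE id_lfunE.
Qed.

(** Each B(u) is a scalar times T - x(u), so this turns a product of Bethe operators into a
    polynomial in T. *)
Lemma big_comp_poly_act T (I : Type) (r : seq I) (k x : I -> F) v :
  (\big[@comp_lfun F V V V / \1%VF]_(i <- r) (k i *: (T - x i *: \1%VF))) v
  = (\prod_(i <- r) k i) *: poly_act T (\prod_(i <- r) ('X - (x i)%:P)) v.
Proof.
elim: r => [|i r IHr]; first by rewrite !big_nil id_lfunE poly_act1 scale1r.
by rewrite !big_cons comp_lfunE IHr poly_act_XsubC scale_lfunE linearZ scalerA.
Qed.

Lemma iter_linear T n : linear (iter n T).
Proof. by elim: n => // n IHn a v w; rewrite /= IHn linearP. Qed.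

Lemma iter_lfunD T n v w : iter n T (v + w) = iter n T v + iter n T w.
Proof. by rewrite -[v]scale1r iter_linear !scale1r. Qed.

Lemma iter_lfunZ T n a v : iter n T (a *: v) = a *: iter n T v.
Proof.
by elim: n => // n IHn; rewrite !iterS IHn linearZ.
Qed.

Lemma poly_act_is_linear T p : linear (poly_act T p).
Proof.
move=> a v w; rewrite /poly_act /lext scaler_sumr -big_split /=.
by apply: eq_bigr => i _; rewrite iter_linear scalerDr !scalerA mulrC.
Qed.

HB.instance Definition _ T p :=
  GRing.isLinear.Build F V V *:%R (poly_act T p) (poly_act_is_linear T p).

End PolyAct.

(** * The q-difference operator D and its eigenpolynomials *)

Section SpectralTransform.
Variables (F : fieldType) (V : vectType F) (A T : 'End(V)) (v0 : V).
Variables (th : nat -> F) (tau bt g h : F).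
Hypothesis A0 : A v0 = th 0%N *: v0.
Hypothesis A1 : A (T v0) = th 1%N *: T v0 + tau *: v0.
Hypothesis ATT : forall w,
  A (T (T w)) = bt *: T (A (T w)) - T (T (A w)) - A w + g *: T w + h *: w.
Hypothesis thS : forall n, th n.+2 = bt * th n.+1 - th n.

(** [Lpoly n] is D applied to the n-th monomial. The recursion has order two, hence the pair of
    consecutive values. *)
Fixpoint Lpair n : {poly F} * {poly F} :=
  if n is n'.+1 then
    let: (l0, l1) := Lpair n' in
    (l1, bt *: (l1 * 'X) - l0 * 'X * 'X - l0 + g *: ('X^n' * 'X) + h *: 'X^n')
  else ((th 0%N)%:P, th 1%N *: 'X + tau%:P).

Definition Lpoly n := (Lpair n).1.

Lemma Lpoly0 : Lpoly 0 = (th 0%N)%:P. Proof. by []. Qed.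
Lemma Lpoly1 : Lpoly 1 = th 1%N *: 'X + tau%:P. Proof. by []. Qed.
Lemma LpolyS n : Lpoly n.+2 = bt *: (Lpoly n.+1 * 'X) - Lpoly n * 'X * 'X - Lpoly n
   + g *: ('X^n * 'X) + h *: 'X^n.
Proof. by rewrite /Lpoly /=; case: (Lpair n). Qed.

Lemma poly_actXn n : poly_act T 'X^n v0 = iter n T v0.
Proof.
elim: n => [|n IHn]; first exact: poly_act1.
by rewrite exprSr poly_actMX IHn.
Qed.

(** [ATT] at w = T^n v0 is the recursion of [Lpoly]; the induction carries two consecutive
    indices. *)
Lemma A_iter n : A (iter n T v0) = poly_act T (Lpoly n) v0.
Proof.
suff: A (iter n T v0) = poly_act T (Lpoly n) v0 /\
  A (iter n.+1 T v0) = poly_act T (Lpoly n.+1) v0 by case.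
elim: n => [|n [IH0 IH1]].
  rewrite /= A0 A1 Lpoly0 Lpoly1 /poly_act lextC linearD linearZ /= lextC; split=> //.
  by rewrite -['X]mul1r lextMX lextC scale1r.
split=> //; rewrite [iter n.+2 _ _]/= ATT -iterS IH1 IH0 LpolyS /poly_act.
by rewrite !(linearB, linearD, linearZ) /= -!poly_actE !poly_actMX poly_actXn.
Qed.

Lemma A_poly_act p : A (poly_act T p v0) = poly_act T (lext Lpoly p) v0.
Proof.
rewrite {1}/poly_act lext_comp (eq_lext A_iter).
by rewrite [RHS](lext_comp (lext (fun i => iter i T v0))).
Qed.

(** The leading coefficients obey [thS], so D is triangular on monomials with diagonal [th]. *)
Lemma size_Lpoly n : (size (Lpoly n) <= n.+1)%N /\ (Lpoly n)`_n = th n.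
Proof.
suff: forall n, (forall j, (n < j)%N -> (Lpoly n)`_j = 0) /\ (Lpoly n)`_n = th n.
  by move=> /(_ n) [s0 ->]; split=> //; apply/leq_sizeP.
move=> {}n; suff: ((forall j, (n < j)%N -> (Lpoly n)`_j = 0) /\ (Lpoly n)`_n = th n)
  /\ ((forall j, (n.+1 < j)%N -> (Lpoly n.+1)`_j = 0) /\ (Lpoly n.+1)`_n.+1 = th n.+1).
  by case.
elim: n => [|n [[s0 l0] [s1 l1]]].
  split; split=> [j|]; rewrite ?Lpoly0 ?Lpoly1 ?(coefD, coefZ, coefX, coefC) //=.
  - by case: j.
  - by case: j => // -[] // j _; rewrite /= mulr0 addr0.
  by rewrite mulr1 addr0.
split=> //; split=> [[|[|j]] // lt_nj|].
  rewrite LpolyS !(coefD, coefN, coefZ, coefMX, coefXn) /=.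
  by rewrite s1 ?s0 //= ?(gtn_eqF) ?mulr0 ?oppr0 ?addr0 //; lia.
rewrite LpolyS !(coefD, coefN, coefZ, coefMX, coefXn) /= l1 l0 thS.
by rewrite s0 ?gtn_eqF ?(mulr0, oppr0, addr0) //; lia.
Qed.

(* y1 and y2 are the q-shifts of the node t.  On polynomials vanishing at t, the
   q-difference operator only involves the differences Lpoly n.+1 - t Lpoly n, in which
   the inhomogeneous term g X + h of the recursion cancels; this is why the poles of its
   coefficients at b(u^2) b(q^2 u^2) = 0 do not matter. *)
Definition shift_point t a1 a2 y1 y2 :=
  [/\ y1 ^+ 2 = bt * t * y1 - t ^+ 2 - 1, y2 ^+ 2 = bt * t * y2 - t ^+ 2 - 1,
      a1 + a2 = (th 1%N - th 0%N) * t + tau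
    & a1 * y1 + a2 * y2 = (bt - 1) * t * (th 1%N * t + tau)
                           - (t ^+ 2 + 1) * th 0%N + g * t + h].

(** The differences d_n on the left satisfy d_(n+2) = bt t d_(n+1) - (t^2 + 1) d_n, whose
    characteristic roots are y1 and y2; a1 and a2 are fixed by d_0 and d_1. *)
Lemma Lpoly_diff t a1 a2 y1 y2 n : shift_point t a1 a2 y1 y2 ->
  (Lpoly n.+1).[t] - t * (Lpoly n).[t] = a1 * y1 ^+ n + a2 * y2 ^+ n.
Proof.
case=> y1E y2E a0 a1E.
pose hE := (hornerD, hornerN, hornerZ, hornerMX, hornerX, hornerC, hornerXn).
have E0 : (Lpoly 1).[t] - t * (Lpoly 0).[t] = a1 + a2.
  by rewrite a0 Lpoly0 Lpoly1 !hE; ring.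
have E1 : (Lpoly 2).[t] - t * (Lpoly 1).[t] = a1 * y1 + a2 * y2.
  by rewrite a1E LpolyS Lpoly0 Lpoly1 !hE; ring.
suff: (Lpoly n.+1).[t] - t * (Lpoly n).[t] = a1 * y1 ^+ n + a2 * y2 ^+ n
   /\ (Lpoly n.+2).[t] - t * (Lpoly n.+1).[t] = a1 * y1 ^+ n.+1 + a2 * y2 ^+ n.+1.
  by case.
elim: n => [|n [IH0 IH1]]; first by rewrite E0 E1 !expr0 !expr1 !mulr1.
split=> //.
have -> : (Lpoly n.+3).[t] - t * (Lpoly n.+2).[t]
  = bt * t * ((Lpoly n.+2).[t] - t * (Lpoly n.+1).[t])
    - (t ^+ 2 + 1) * ((Lpoly n.+1).[t] - t * (Lpoly n).[t]).
  rewrite (LpolyS n.+1) !hE.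
  have -> : t * (Lpoly n.+2).[t] = t * (bt * ((Lpoly n.+1).[t] * t)
      - (Lpoly n).[t] * t * t - (Lpoly n).[t] + g * (t ^+ n * t) + h * t ^+ n).
    by rewrite LpolyS !hE.
  by rewrite !exprS; ring.
have -> : y1 ^+ n.+2 = y1 ^+ n * y1 ^+ 2 by rewrite -exprD addn2.
have -> : y2 ^+ n.+2 = y2 ^+ n * y2 ^+ 2 by rewrite -exprD addn2.
by rewrite IH1 IH0 y1E y2E !exprS; ring.
Qed.

(** Both sides are linear in r, and on monomials the identity is [Lpoly_diff]. *)
Lemma Lop_root t a1 a2 y1 y2 r : shift_point t a1 a2 y1 y2 ->
  (lext Lpoly (('X - t%:P) * r)).[t] = a1 * r.[y1] + a2 * r.[y2].
Proof.
move=> sp; rewrite mulrBl linearB mul_polyC linearZ /= -commr_polyX lextMX.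
have hE f (p : {poly F}) : (lext f p).[t] = \sum_(i < size p) p`_i * (f i).[t].
  by rewrite /lext horner_sum; apply: eq_bigr => i _; rewrite hornerZ.
rewrite hornerD hornerN hornerZ !hE !horner_coef !mulr_sumr -sumrB -big_split /=.
apply: eq_bigr => i _.
by rewrite mulrCA -mulrBr (Lpoly_diff i sp) mulrDr !(mulrCA r`_i).
Qed.

(** By triangularity D p - th_M p has degree below M. The hypothesis on the nodes says, through
    [Lop_root], that it vanishes at M distinct points, so it is zero. *)
Lemma spectral_transform M (t : 'I_M -> F) :
  injective t ->
  (forall i, exists a1 a2 y1 y2, shift_point (t i) a1 a2 y1 y2 /\
    a1 * (\prod_(j < M | j != i) (y1 - t j))
    + a2 * (\prod_(j < M | j != i) (y2 - t j)) = 0) ->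
  let w := poly_act T (\prod_(i < M) ('X - (t i)%:P)) v0 in
  A w = th M *: w.
Proof.
move=> t_inj bethe; set p := (\prod_(i < M) _) => /=.
have p_mon : p \is monic by exact: monic_prod_XsubC.
have size_p : size p = M.+1 by rewrite /p size_prod_XsubC /index_enum -enumT size_enum_ord.
rewrite A_poly_act.
suff -> : lext Lpoly p = th M *: p by rewrite {1}/poly_act linearZ.
apply/eqP; rewrite -subr_eq0; apply/eqP.
apply: (@roots_geq_poly_eq0 _ _ [seq t i | i : 'I_M]).
- apply/allP => _ /mapP [i _ ->]; rewrite rootE hornerD hornerN hornerZ.
  have [a1 [a2 [y1 [y2 [sp E]]]]] := bethe i.
  rewrite {1 2}/p (bigD1 i) //= (Lop_root _ sp) hornerM hornerXsubC subrr mul0r mulr0 subr0.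
  rewrite !horner_prod -[X in _ == X]E; apply/eqP; congr (_ * _ + _ * _);
    by apply: eq_bigr => j _; rewrite hornerXsubC.
- by rewrite map_inj_uniq ?enum_uniq.
(* For j >= M only the summand of index M reaches the coefficient j; at j = M it cancels against
   th_M p_M. *)
rewrite size_map size_enum_ord; apply/leq_sizeP => j le_Mj.
rewrite coefD coefN coefZ /lext size_p coef_sum big_ord_recr /= big1 => [|i _]; last first.
  rewrite coefZ [(Lpoly i)`_j]nth_default ?mulr0 //.
  exact: leq_trans (proj1 (size_Lpoly i)) (leq_trans (ltn_ord i) le_Mj).
rewrite add0r coefZ; case: (ltngtP M j) le_Mj => // [lt_Mj|<-] _; last first.
  by rewrite (proj2 (size_Lpoly M)) mulrC subrr.
rewrite (nth_default _ (leq_trans (proj1 (size_Lpoly M)) lt_Mj)) mulr0 sub0r.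
by rewrite nth_default ?mulr0 ?oppr0 // size_p.
Qed.

End SpectralTransform.

(** * The operator T and its relations with A and [As] *)

Section Top.
Variables (F : fieldType) (P : params F) (V : vectType F) (A As : 'End(V)).

Definition Top : 'End(V) :=
  (rho P)^-1 *: (qcomm (pq P) As A + (omega P / (pq P - (pq P)^-1)) *: \1%VF).

Definition xroot (u : F) : F :=
  - ((pq P * u ^+ 2 + (pq P)^-1 * u ^- 2) / (pq P ^+ 2 - pq P ^- 2)).

Lemma calBE chi u :
  calB P A As chi u = (chi * bfun (u ^+ 2)) *: (Top - xroot u *: \1%VF).
Proof. by rewrite /calB /xroot scaleNr opprK. Qed.

Lemma qcommE r (X Y : 'End(V)) v : qcomm r X Y v = r *: X (Y v) - r^-1 *: Y (X v).
Proof. by rewrite /qcomm add_lfunE opp_lfunE !scale_lfunE !comp_lfunE. Qed.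

Lemma TopE v : Top v = (rho P)^-1 *: (pq P *: As (A v) - (pq P)^-1 *: A (As v)
   + (omega P / (pq P - (pq P)^-1)) *: v).
Proof. by rewrite /Top scale_lfunE add_lfunE qcommE scale_lfunE id_lfunE. Qed.

(** Reduces vector identities to scalar ones, where [ring] and [field] apply. *)
Lemma coord_inj (v w : V) :
  (forall i, coord (vbasis {:V}) i v = coord (vbasis {:V}) i w) -> v = w.
Proof.
move=> vw; rewrite (coord_vbasis (memvf v)) (coord_vbasis (memvf w)).
by apply: eq_bigr => i _; rewrite vw.
Qed.

Hypotheses (q0 : pq P != 0) (qq1 : pq P * pq P - 1 != 0) (rho0 : rho P != 0).
Hypothesis AW : askey_wilson_relations P A As.

(** The first Askey-Wilson relation expressed through T: the constant omega / (q - q^-1) in T is the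
    one that absorbs the term omega A. *)
Lemma As_Top v :
  As v = (pq P)^-1 *: Top (A v) - pq P *: A (Top v) - (Defs.eta P / rho P) *: v.
Proof.
have /(congr1 (fun f : 'End(V) => f v)) := AW.1.
rewrite !(qcommE, TopE, add_lfunE, scale_lfunE, id_lfunE) => E.
apply: coord_inj => i; move/(congr1 (coord (vbasis {:V}) i)): E.
rewrite !(linearB, linearD, linearZ) /= /GRing.scale /= invrK => E.
apply: (mulfI rho0); rewrite !mulrBr.
have -> : forall x, rho P * (Defs.eta P / rho P * x) = Defs.eta P * x.
  by move=> x; field.
move/eqP: E; rewrite -subr_eq -subr_eq => /eqP <-; field.
by rewrite q0 rho0 qq1.
Qed.

Lemma A_Top v :
  A v = (pq P)^-1 *: As (Top v) - pq P *: Top (As v)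
        - (eta_star P / rho P) *: v.
Proof.
have /(congr1 (fun f : 'End(V) => f v)) := AW.2.
rewrite !(qcommE, TopE, add_lfunE, scale_lfunE, id_lfunE) => E.
apply: coord_inj => i; move/(congr1 (coord (vbasis {:V}) i)): E.
rewrite !(linearB, linearD, linearZ) /= /GRing.scale /= invrK => E.
apply: (mulfI rho0); rewrite !mulrBr.
have -> : forall x, rho P * (eta_star P / rho P * x) = eta_star P * x.
  by move=> x; field.
move/eqP: E; rewrite -subr_eq -subr_eq => /eqP <-; field.
by rewrite q0 rho0 qq1.
Qed.

(** Substituting [As_Top] into [A_Top] eliminates [As] and leaves a relation between A and T alone,
    which is the hypothesis [ATT] of the spectral transform. *)
Lemma A_Top_Top v :
  A (Top (Top v)) = (pq P ^+ 2 + pq P ^- 2) *: Top (A (Top v))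
    - Top (Top (A v)) - A v + (Defs.eta P / rho P * (pq P - (pq P)^-1)) *: Top v
    + - (eta_star P / rho P) *: v.
Proof.
have := A_Top v; rewrite !As_Top => E.
apply: coord_inj => i; move/(congr1 (coord (vbasis {:V}) i)): E.
rewrite !(linearB, linearD, linearZ) /= /GRing.scale /= => E.
(* Subtracting the vanishing quantity [E0] from the left side turns the goal into a rational
   identity. *)
move/eqP: (E); rewrite -subr_eq0 => /eqP E0; rewrite -[LHS]subr0 -E0; field.
by rewrite q0 rho0.
Qed.

End Top.

(** * Integer powers of q *)

Section Exponents.
Variables (F : fieldType) (q : F).
Hypothesis q0 : q != 0.

Lemma expz2M (n : nat) : q ^ (2 * n%:Z) = (q ^+ 2) ^+ n.
Proof. by rewrite -exprM. Qed.

Lemma expz4M (n : nat) : q ^ (4 * n%:Z) = ((q ^+ 2) ^+ n) ^+ 2.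
Proof. have -> : 4 * n%:Z = (2 * (n * 2))%N%:Z :> int by lia. by rewrite -!exprM. Qed.

Lemma expzN (n : int) : q ^ (- n) = (q ^ n)^-1.
Proof. by rewrite invr_expz. Qed.

Lemma expz_nat (n : nat) : q ^ n%:Z = q ^+ n. Proof. by []. Qed.

Lemma expzD (m n : int) : q ^ (m + n) = q ^ m * q ^ n.
Proof. exact: expfzDr. Qed.

(** Brings exponents to powers of q^2 and of q, which are then generalized to indeterminates before
    [field]. *)
Definition expzE := (expzD, expz2M, expz4M, expzN, expr1z, expz_nat).

End Exponents.

(** * Consequences of genericity, and the Bethe equations as q-shift relations *)

Section Scalars.
Variables (F : fieldType) (P : params F).
Local Notation q := (pq P).
Local Notation b := (pb P).
Local Notation c := (pc P).
Local Notation bs := (pbs P).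
Local Notation cs := (pcs P).
Local Notation z := (pz P).
Local Notation Q := (pq P ^+ p2s P).

Lemma thetaE n : pq P != 0 -> theta P n = b * (q ^+ 2) ^+ n + c * ((q ^+ 2) ^+ n)^-1.
Proof. by move=> q0; rewrite /theta !(expzE q0). Qed.

Lemma theta_rec n : q != 0 ->
  theta P n.+2 = (q ^+ 2 + q ^- 2) * theta P n.+1 - theta P n.
Proof.
move=> q0; rewrite !thetaE // !(exprS (q ^+ 2)); set y := (q ^+ 2) ^+ n.
have y0 : y != 0 by rewrite !expf_neq0.
by field; rewrite y0 q0.
Qed.

Lemma coef_upE n : q != 0 -> let y := (q ^+ 2) ^+ n in
  coef_up P n = q ^+ 2 / (q ^+ 2) ^+ p2s P *
  ((1 - y) * (c - b * (y * (q ^+ 2) ^+ p2s P))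
   * (bs * (Q / q) * z ^- 2 + b * (y / q ^+ 2))
   * (c * (Q / q) * z ^+ 2 + cs * (y / q ^+ 2)))
  / ((c - b * (y ^+ 2 / q ^+ 2)) * (c - b * y ^+ 2)).
Proof.
by move=> q0 /=; rewrite /coef_up !(expzE q0).
Qed.

Lemma coef_up0 : coef_up P 0 = 0.
Proof. by rewrite /coef_up mulr0 expr0z subrr !(mul0r, mulr0). Qed.

Lemma coef_downE n : q != 0 -> let y := (q ^+ 2) ^+ n in
  coef_down P n = ((1 - y / (q ^+ 2) ^+ p2s P / q ^+ 2) * (c - b * (y / q ^+ 2))
   * (c + bs * z ^- 2 * (y * Q / q))
   * (cs + b * z ^+ 2 * (y * Q / q)))
  / ((c - b * (y ^+ 2 / q ^+ 4)) * (c - b * (y ^+ 2 / q ^+ 2))).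
Proof.
by move=> q0 /=; rewrite /coef_down !(expzE q0).
Qed.

Hypothesis G : generic P.

Lemma generic_q0 : q != 0. Proof. by case: G => [[[]]]. Qed.
Lemma generic_b0 : b != 0. Proof. by case: G => [[[]]]. Qed.
Lemma generic_c0 : c != 0. Proof. by case: G => [[[]]]. Qed.
Lemma generic_bs0 : bs != 0. Proof. by case: G => [[[]]]. Qed.
Lemma generic_cs0 : cs != 0. Proof. by case: G => [[[]]]. Qed.
Lemma generic_z0 : z != 0. Proof. by case: G => [[[]]]. Qed.

Lemma generic_expq k : (0 < k)%N -> q ^+ k - 1 != 0.
Proof. by move=> k0; case: G => _ /(_ _ k0); rewrite subr_eq0. Qed.

Lemma expq_inj i j : (q ^+ 2) ^+ i = (q ^+ 2) ^+ j -> i = j.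
Proof.
wlog le_ij : i j / (i <= j)%N.
  by move=> H; case: (leqP i j) => [|/ltnW] /H // + /esym => /[apply].
rewrite -(subnKC le_ij) exprD -[LHS]mulr1; case: (j - i)%N => [|d].
  by rewrite addn0.
have q20 : (q ^+ 2) ^+ i != 0 by rewrite !expf_neq0 ?generic_q0.
move/(mulfI q20)/esym/eqP; rewrite -subr_eq0 -exprM.
by have := @generic_expq (2 * d.+1)%N isT => /negPf ->.
Qed.

Lemma generic_bs : bs = b * c / cs.
Proof. by case: G => _ _ -> _ _; rewrite mulfK ?generic_cs0. Qed.

Lemma generic_cb k : (k <= 2 * p2s P)%N -> c - b * (q ^+ 2) ^+ k != 0.
Proof. by move=> lek; case: G => _ _ _ /(_ _ lek) [+ _] _; rewrite exprM subr_eq0. Qed.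

Lemma generic_qq1 : q * q - 1 != 0. Proof. exact: (@generic_expq 2). Qed.
Lemma generic_q21 : q ^+ 2 + 1 != 0.
Proof.
have := @generic_expq 4 isT; have -> : q ^+ 4 - 1 = (q ^+ 2 - 1) * (q ^+ 2 + 1) by ring.
by rewrite mulf_eq0 negb_or => /andP[].
Qed.
Lemma generic_q41 : (q * q) ^+ 2 - 1 != 0.
Proof. by have := @generic_expq 4 isT; rewrite (exprM _ 2 2). Qed.

Lemma generic_q2V : q ^+ 2 - q ^- 2 != 0.
Proof.
have q0 := generic_q0; apply: contraNneq generic_q41 => E; apply/eqP.
transitivity (q ^+ 2 * (q ^+ 2 - q ^- 2)); first by field.
by rewrite E mulr0.
Qed.

Lemma generic_rho : rho P != 0.
Proof.
have := (generic_b0, generic_c0, generic_q2V) => -[[b0 c0] e2].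
by rewrite /rho mulf_neq0 ?oppr_eq0 ?mulf_neq0 ?expf_neq0.
Qed.

(** The diagonal entry of T in the eigenbasis of A: [As, A]_q contributes (q - q^-1) theta_k times
    the diagonal entry of [As]. *)
Definition top_diag k : F :=
  (rho P)^-1 * ((q - q^-1) * theta P k * coef_diag P k + omega P / (q - q^-1)).

(** T|theta_0> lies in the span of |theta_0> and |theta_1>; [tau] is the resulting defect A
    T|theta_0> - theta_1 T|theta_0> along |theta_0>. *)
Definition tau : F := (theta P 0 - theta P 1) * top_diag 0.

(** [Lambda1] and [Lambda2] at epsilon = -1 are these cores times u / (Q q), the second one also
    times b(u^2) / b(q u^2). *)
Definition lambda1_core (u : F) : F :=
  (Q * q * u * z^-1 - u^-1 * z) * (Q * q * u * z - u^-1 * z^-1)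
  * (u * cs * Q^-1 + u^-1 * b * Q) * (u * (c / cs) + u^-1).

Definition lambda2_core (u : F) : F :=
  (Q / q * u^-1 * z - u * z^-1) * (Q / q * u^-1 * z^-1 - u * z)
  * (q ^+ 2 * u * b * Q + u^-1 * cs * Q^-1) * (q ^+ 2 * u + u^-1 * (c / cs)).

Definition shift_den (u : F) : F := Q * q * (q + q^-1) * bfun (q * u ^+ 2).

Lemma bfun_eq0 (x : F) : x != 0 -> (bfun x == 0) = (x ^+ 2 - 1 == 0).
Proof.
move=> x0; have -> : x ^+ 2 - 1 = x * bfun x by rewrite /bfun; field.
by rewrite mulf_eq0 (negPf x0).
Qed.

(** The points x(qu) and x(u/q) have sum (q^2 + q^-2) x(u) and product x(u)^2 + 1, so they are the
    two roots of the quadratic of [shift_point]. The other two conditions are rational identities in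
    the parameters. *)
Lemma shift_point_xroot (u : F) : (0 < p2s P)%N -> u != 0 -> bfun (q * u ^+ 2) != 0 ->
  shift_point (theta P) tau (q ^+ 2 + q ^- 2) (Defs.eta P / rho P * (q - q^-1))
   (- (eta_star P / rho P)) (xroot P u)
   (- lambda2_core u / shift_den u) (lambda1_core u / shift_den u) (xroot P (q * u)) (xroot P (u / q)).
Proof.
move=> s0 u0.
have := (generic_q0, generic_b0, generic_c0, generic_cs0, generic_z0, generic_q21).
move=> [[[[[q0 b0] c0] cs0] z0] h3].
(* Positive spin makes c - b q^2 nonzero; it is a denominator of [coef_down P 1], which enters
   [tau]. *)
have := (@generic_cb 0 isT, @generic_cb 1 ltac:(lia)); rewrite expr0 expr1 mulr1.
move=> [h4 h5].
have thetaS : theta (swapbc P) 0 = bs + cs.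
  by rewrite /theta /= mulr0 oppr0 expr0z !mulr1.
have := (generic_qq1, generic_q41) => -[e1 e2].
have e3 : q * q + 1 != 0 := h3.
have e4 : - (b * c) != 0 by rewrite oppr_eq0 mulf_neq0.
have Q0 : Q != 0 by rewrite expf_neq0.
rewrite bfun_eq0 ?mulf_neq0 ?expf_neq0 // => e5.
split.
- by rewrite /xroot; field; rewrite q0 u0 e2.
- by rewrite /xroot; field; rewrite q0 u0 e2.
- rewrite /shift_den /xroot /tau /top_diag /coef_diag /lambda1_core /lambda2_core.
  rewrite /omega /rho /bfun /theta_star.
  rewrite coef_up0 coef_downE // !(thetaE, thetaS) // !(expzE q0).
  (* With the power of q^2 written as Q^2 and [bs] as b c / cs, the remaining parameters are free
     variables for [field]. *)
  rewrite (exprAC (pq P) 2 (p2s P)) expr0 !expr1 /= generic_bs.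
  move: Q Q0 => Qt Q0; field.
  by rewrite q0 e1 Q0 cs0 z0 h5 h4 oner_neq0 e2 e4 u0 e5 e3.
rewrite /shift_den /xroot /tau /top_diag /coef_diag /lambda1_core /lambda2_core.
rewrite /eta_star /Defs.eta /omega /rho.
rewrite /bfun /theta_star /= coef_up0 coef_downE // !(thetaE, thetaS) // !(expzE q0).
rewrite (exprAC (pq P) 2 (p2s P)) expr0 !expr1 /= generic_bs.
move: Q Q0 => Qt Q0; field.
by rewrite q0 e1 Q0 cs0 z0 h5 h4 oner_neq0 e2 e4 u0 e5 e3.
Qed.

Lemma xroot_sub (u v : F) : u != 0 -> v != 0 ->
  xroot P u - xroot P v = - (bfun (q * u * v) * bfun (u / v)) / (q ^+ 2 - q ^- 2).
Proof.
move=> u0 v0; have := (generic_q0, generic_q41) => -[q0 e2].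
by rewrite /xroot /bfun; field; rewrite q0 u0 v0 e2.
Qed.

(** With its counterpart for u / q, this is how the products over roots in D become the products of
    [hBethe] and [fBethe] in the Bethe equations. *)
Lemma xroot_sub_mulq (u v : F) : u != 0 -> v != 0 -> xroot P u != xroot P v ->
  xroot P (q * u) - xroot P v = hBethe P u v * (xroot P u - xroot P v).
Proof.
move=> u0 v0; have q0 := generic_q0.
have qu0 : q * u != 0 by rewrite mulf_neq0.
rewrite -subr_eq0 !xroot_sub // mulf_eq0 oppr_eq0 mulf_eq0 !negb_or.
move=> /andP[/andP[b1 b2] e2]; rewrite /hBethe.
have -> : q ^+ 2 * u * v = q * (q * u) * v by ring.
by rewrite [RHS]mulrA mulrN divfK ?mulf_neq0.
Qed.

Lemma xroot_sub_divq (u v : F) : u != 0 -> v != 0 -> xroot P u != xroot P v ->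
  xroot P (u / q) - xroot P v = fBethe P u v * (xroot P u - xroot P v).
Proof.
move=> u0 v0; have q0 := generic_q0.
have qu0 : u / q != 0 by rewrite mulf_neq0 ?invr_eq0.
rewrite -subr_eq0 !xroot_sub // mulf_eq0 oppr_eq0 mulf_eq0 !negb_or.
move=> /andP[/andP[b1 b2] e2]; rewrite /fBethe.
have bV (x : F) : bfun x^-1 = - bfun x by rewrite /bfun invrK opprB.
have -> : q * (u / q) * v = u * v by field.
have -> : u / q / v = (q * v / u)^-1 by field; rewrite q0 u0 v0.
have -> : v / u = (u / v)^-1 by rewrite invf_div.
rewrite !bV; move: (q ^+ 2 - _) (bfun (q * u * v)) (bfun (u / v)) e2 b1 b2 => D B1 B2.
by rewrite invr_eq0 => D0 B10 B20; field; rewrite D0 B10 oppr_eq0 B20.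
Qed.

(** [USym] is a constant multiple of [xroot], so admissibility means distinct roots. *)
Lemma xroot_inj_USym (u v : F) : USym P u != USym P v -> xroot P u != xroot P v.
Proof.
have := (generic_q0, generic_q41, generic_qq1, generic_q21) => -[[[q0 e2] e1] h3].
apply: contraNneq => E; apply/eqP.
have US w : USym P w = - (xroot P w) * (q - q^-1).
  rewrite /USym /xroot opprK; move: (w ^+ 2) (w ^- 2) => x y; field.
  by rewrite q0 e2 h3.
by rewrite !US E.
Qed.

(** The left side is the i-th Bethe equation up to nonzero factors and the product d of the root
    differences. *)
Lemma bethe_shift M (u : M.-tuple F) : bethe_solution P false u -> forall i,
  let ui := tnth u i in
  - lambda2_core ui / shift_den ui
    * (\prod_(j < M | j != i) (xroot P (q * ui) - xroot P (tnth u j)))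
  + lambda1_core ui / shift_den ui
    * (\prod_(j < M | j != i) (xroot P (ui / q) - xroot P (tnth u j))) = 0.
Proof.
case=> nt adm bq0 bethe i /=; have q0 := generic_q0.
have u0 j : tnth u j != 0 by case: (nt j).
have Q0 : Q != 0 by rewrite expf_neq0.
have cs0 := generic_cs0; have z0 := generic_z0.
have x_neq j : j != i -> xroot P (tnth u i) != xroot P (tnth u j).
  by move=> ji; apply: xroot_inj_USym; apply: adm; rewrite eq_sym.
rewrite (eq_bigr _ (fun j ji => xroot_sub_mulq (u0 i) (u0 j) (x_neq j ji))).
rewrite (eq_bigr _ (fun j ji => xroot_sub_divq (u0 i) (u0 j) (x_neq j ji))).
pose f := \prod_(j < M | j != i) fBethe P (tnth u i) (tnth u j).
pose h := \prod_(j < M | j != i) hBethe P (tnth u i) (tnth u j).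
pose d := \prod_(j < M | j != i) (xroot P (tnth u i) - xroot P (tnth u j)).
have -> : \prod_(j < M | j != i)
  (hBethe P (tnth u i) (tnth u j) * (xroot P (tnth u i) - xroot P (tnth u j))) = h * d.
  by rewrite big_split.
have -> : \prod_(j < M | j != i)
  (fBethe P (tnth u i) (tnth u j) * (xroot P (tnth u i) - xroot P (tnth u j))) = f * d.
  by rewrite big_split.
have := bethe i; rewrite /EBethe -/f -/h => E.
have Bu : bfun (tnth u i ^+ 2) != 0 by rewrite subr_eq0; case: (nt i).
have L1 : Lambda1 P false (tnth u i) = tnth u i / (Q * q) * lambda1_core (tnth u i).
  rewrite /Lambda1 /lambda1_core /powsign !(expzE q0) /= expr1 expr0; field.
  by rewrite u0 cs0 Q0 z0 q0 oner_neq0.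
have L2 : Lambda2 P false (tnth u i) = tnth u i / (Q * q)
    * (bfun (tnth u i ^+ 2) / bfun (q * tnth u i ^+ 2)) * lambda2_core (tnth u i).
  have := bq0 i; rewrite bfun_eq0 ?mulf_neq0 ?expf_neq0 //.
  rewrite /Lambda2 /lambda2_core /powsign !(expzE q0) /= expr1 expr0 /bfun invfM => bb.
  by field; rewrite cs0 u0 Q0 z0 q0 bb.
move: E; rewrite L1 L2 => E.
(* The factor common to both terms is nonzero by non-triviality and [bq0]; cancelling it leaves the
   cores. *)
have {}E : h * lambda2_core (tnth u i) - f * lambda1_core (tnth u i) = 0.
  apply: (mulfI (_ : tnth u i / (Q * q)
    * (bfun (tnth u i ^+ 2) / bfun (q * tnth u i ^+ 2)) != 0)).
    by rewrite !mulf_neq0 ?invr_eq0 ?mulf_neq0.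
  by rewrite mulr0 -[RHS]E; ring.
transitivity (- (h * lambda2_core (tnth u i) - f * lambda1_core (tnth u i))
  / shift_den (tnth u i) * d).
  by ring.
by rewrite E oppr0 !mul0r.
Qed.

End Scalars.

(** * Tridiagonal operators in a basis *)

Section Tridiagonal.
Variables (F : fieldType) (V : vectType F) (n : nat) (e : n.+1.-tuple V).
Variables (X : 'End(V)) (up diag down : nat -> F).
Hypothesis e_basis : basis_of {:V} e.
Hypothesis X_tri : tridiagonal_action X up diag down e.

Lemma coord_tuple_nth (j : 'I_n.+1) k : (k <= n)%N -> coord e j e`_k = (k == j)%:R.
Proof.
move=> le_kn; rewrite -ltnS in le_kn.
by rewrite (coord_free (Ordinal le_kn) j (basis_free e_basis)).
Qed.

Lemma tuple_expand v : v = \sum_(j < n.+1) coord e j v *: e`_j.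
Proof. exact: coord_basis e_basis (memvf v). Qed.

(** X raises the index by at most one, so m <= j - k steps lead from k to j only if m = j - k and
    every step is a raise. *)
Lemma coord_iter_up (j : 'I_n.+1) m k : (k + m <= j)%N ->
  coord e j (iter m X e`_k) = (k + m == j)%N%:R * \prod_(i < m) up (k + i).+1%N.
Proof.
elim: m k => [|m IHm] k le_kmj.
  by rewrite big_ord0 mulr1 addn0 coord_tuple_nth //; have := ltn_ord j; lia.
have lt_jn := ltn_ord j.
rewrite iterSr X_tri; last by lia.
rewrite !iter_lfunD !iter_lfunZ !linearD !linearZ /= !IHm; try lia.
have -> : coord e j (iter m X (if k is k'.+1 then down k'.+1 *: e`_k' else 0)) = 0.
  case: k le_kmj => [|k] le_kmj.
    by rewrite -(scale0r 0) iter_lfunZ scale0r linear0.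
  have lt_kmj : (k + m < j)%N by lia.
  by rewrite iter_lfunZ linearZ /= IHm ?(ltnW lt_kmj) // (ltn_eqF lt_kmj) /= mulr0n mul0r mulr0.
have lt_kmj : (k + m < j)%N by lia.
rewrite addr0 (ltn_eqF lt_kmj) /= mulr0n mul0r mulr0 addr0.
rewrite big_ord_recl addn0 addSnnS mulrCA; congr (_ * (_ * _)).
by apply: eq_bigr => i _; rewrite /bump /= addSnnS.
Qed.

Lemma coord_poly_act_up (j : 'I_n.+1) p : p \is monic -> size p = j.+1 ->
  coord e j (poly_act X p e`_0) = \prod_(i < j) up i.+1.
Proof.
move=> p_mon size_p; rewrite /poly_act (@scalar_lext_monic _ _ (coord e j) _ _ j) //.
- by rewrite coord_iter_up // add0n eqxx mul1r.
- exact: linearP.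
by move=> i lt_ij; rewrite coord_iter_up add0n 1?ltnW // (ltn_eqF lt_ij) /= mulr0n mul0r.
Qed.

(** The transposed action, giving a recurrence for coordinates. The bound j < n keeps [inord j.+1] a
    genuine index. *)
Lemma coord_tridiagonal (j : 'I_n.+1) v : (j < n)%N ->
  coord e j (X v) =
    (if j : nat is k.+1 then up k.+1 * coord e (inord k) v else 0)
    + diag j * coord e j v + down j.+1 * coord e (inord j.+1) v.
Proof.
move=> lt_jn; rewrite {1}(tuple_expand v) !linear_sum /=.
(* The contribution of e_i to the coordinate j, with Kronecker deltas selecting i = j - 1, j, j +
   1. *)
pose E (i : 'I_n.+1) := coord e i v * ((i.+1 == j)%:R * up i.+1
  + (i == j :> nat)%:R * diag i + (i == j.+1 :> nat)%:R * down i).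
rewrite (eq_bigr E) => [|i _]; last first.
  have lt_i := ltn_ord i.
  have E1 : up i.+1 * coord e j e`_i.+1 = (i.+1 == j)%:R * up i.+1.
    (* For i = n the vector e_(n+1) is the default 0, and the delta vanishes too because j < n. *)
    rewrite mulrC; have [lt_in|le_ni] := ltnP i n; first by rewrite coord_tuple_nth.
    rewrite nth_default ?size_tuple // linear0 gtn_eqF //.
    by rewrite ltnS (leq_trans (ltnW lt_jn)).
  have E2 : coord e j e`_i = (i == j :> nat)%:R by rewrite coord_tuple_nth.
  have E3 : coord e j (if i : nat is k.+1 then down k.+1 *: e`_k else 0)
      = (i == j.+1 :> nat)%:R * down i.
    case: i lt_i {E1 E2} => -[|i] /= _ lt_i; first by rewrite linear0 mul0r.
    by rewrite linearZ /= coord_tuple_nth ?eqSS 1?mulrC // ltnW.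
  rewrite linearZ /= X_tri // /E -E1 -E2 -E3 [coord e j e`_i * _]mulrC.
  by rewrite !linearD !linearZ /= !mulrDr.
have deltaE (d : 'I_n.+1) (f : 'I_n.+1 -> F) :
    \sum_(i < n.+1) f i * (i == d :> nat)%:R = f d.
  rewrite (bigD1 d) //= eqxx mulr1 big1 ?addr0 // => i.
  by rewrite -val_eqE /= => /negPf ->; rewrite mulr0.
pose f1 (i : 'I_n.+1) := coord e i v * up i.+1 * (i.+1 == j)%:R.
pose f2 (i : 'I_n.+1) := coord e i v * diag i * (i == j :> nat)%:R.
pose f3 (i : 'I_n.+1) := coord e i v * down i * (i == (inord j.+1 : 'I_n.+1) :> nat)%:R.
rewrite (eq_bigr (fun i => f1 i + f2 i + f3 i)) => [|i _]; last first.
  by rewrite /E /f1 /f2 /f3 inordK ?ltnS //; ring.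
rewrite !big_split /= /f2 /f3 !deltaE inordK ?ltnS //.
rewrite [diag j * _]mulrC [down j.+1 * _]mulrC; congr (_ + _ + _); rewrite /f1.
case: j lt_jn {f1 f2 f3 E} => -[|j] /= lt_j lt_jn.
  by rewrite big1 // => i _; rewrite mulr0.
have jK : (inord j : 'I_n.+1) = j :> nat := inordK (ltnW lt_j).
rewrite mulrC -[X in up X.+1]jK -(deltaE (inord j) (fun i => coord e i v * up i.+1)).
by apply: eq_bigr => i _; rewrite jK.
Qed.

(** The dual of [coord_iter_up]: X lowers the index by at most one, so a functional living on e_0
    sees X^m e_k with m <= k only through k successive lowerings. *)
Lemma functional_iter_down (phi : V -> F) k m : scalar phi ->
  (forall i, (0 < i <= n)%N -> phi e`_i = 0) -> (m <= k)%N -> (k <= n)%N ->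
  phi (iter m X e`_k) = (m == k)%:R * \prod_(i < k) down i.+1 * phi e`_0.
Proof.
move=> phi_lin phi0.
have phiD u v : phi (u + v) = phi u + phi v.
  by rewrite -[u]scale1r phi_lin mul1r scale1r.
have phiZ a u : phi (a *: u) = a * phi u.
  by apply: (addIr (phi 0)); rewrite -phi_lin -phiD addr0.
elim: m k => [|m IHm] [|k] // lt_mk le_kn; first by rewrite big_ord0 !mul1r.
  by rewrite /= (phi0 k.+1) ?le_kn // !mul0r.
rewrite iterSr X_tri // !iter_lfunD !iter_lfunZ !phiD !phiZ.
rewrite (IHm k) //; last exact: ltnW.
rewrite (IHm k.+1) //; last exact: ltnW.
rewrite (@ltn_eqF m k.+1) //= mulr0n !mul0r mulr0 addr0 eqSS.
suff -> : up k.+2 * phi (iter m X e`_k.+2) = 0.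
  by rewrite add0r big_ord_recr /=; ring.
have [le_k2n|lt_nk2] := leqP k.+2 n; last first.
  rewrite nth_default ?size_tuple // -(scale0r 0) iter_lfunZ scale0r.
  by rewrite -(scale0r 0) phiZ mul0r mulr0.
by rewrite IHm // ?(ltn_eqF (ltnW _)) //= ?mulr0n ?mul0r ?mulr0 // ltnW // ltnW.
Qed.

Lemma functional_poly_act_down (phi : V -> F) k p : scalar phi ->
  (forall i, (0 < i <= n)%N -> phi e`_i = 0) -> (k <= n)%N ->
  p \is monic -> (size p <= k.+1)%N ->
  phi (poly_act X p e`_k) = (size p == k.+1)%:R * \prod_(i < k) down i.+1 * phi e`_0.
Proof.
move=> phi_lin phi0 le_kn p_mon; rewrite leq_eqVlt ltnS; case/predU1P=> [size_p|size_p].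
  rewrite /poly_act (@scalar_lext_monic _ _ phi _ _ k) ?size_p //.
    by rewrite functional_iter_down // !eqxx.
  move=> i lt_ik; rewrite functional_iter_down // ?(ltn_eqF lt_ik) 1?ltnW //=.
  by rewrite mulr0n !mul0r.
rewrite ltn_eqF //= mulr0n !mul0r /poly_act scalar_lext // big1 // => i _.
have lt_ik : (i < k)%N := leq_trans (ltn_ord i) size_p.
by rewrite functional_iter_down // ?(ltn_eqF lt_ik) 1?ltnW //= mulr0n !mul0r mulr0.
Qed.

(** Comparing the coordinates i of both sides gives (th_i - th_j) times the coordinate i of v equal
    to 0. *)
Lemma eigenvector_expand (A : 'End(V)) (th : nat -> F) (j : 'I_n.+1) v :
  (forall i, (i <= n)%N -> A e`_i = th i *: e`_i) ->
  (forall i k, (i <= n)%N -> (k <= n)%N -> th i = th k -> i = k) ->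
  A v = th j *: v -> v = coord e j v *: e`_j.
Proof.
move=> Ae th_inj Av; rewrite {1}(tuple_expand v) (bigD1 j) //= big1 ?addr0 // => i ij.
have := congr1 (coord e i) Av; rewrite {1}(tuple_expand v) linear_sum linearZ /=.
rewrite (eq_bigr (fun k => (coord e k v * th k) *: e`_k)) => [|k _]; last first.
  by rewrite linearZ /= Ae ?scalerA // -ltnS.
rewrite linear_sum (bigD1 i) //= linearZ /= coord_tuple_nth -1?ltnS // eqxx mulr1.
rewrite big1 ?addr0 => [E|k ki]; last first.
  rewrite linearZ /= coord_tuple_nth -1?ltnS //; move: ki; rewrite -val_eqE /= => /negPf ->.
  by rewrite mulr0.
have /eqP := E; rewrite mulrC -subr_eq0 -mulrBl mulf_eq0 => /orP[|/eqP ->].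
  rewrite subr_eq0 => /eqP /th_inj ij'; case/eqP: ij; apply/val_inj.
  by apply: ij'; rewrite -ltnS.
by rewrite scale0r.
Qed.

(** If [up k] vanished, the span of e_0, ..., e_(k-1) would be a proper nonzero subspace stable
    under both operators. *)
Lemma irreducible_up_neq0 (A : 'End(V)) (th : nat -> F) k :
  (forall i, (i <= n)%N -> A e`_i = th i *: e`_i) -> act_irreducibly A X ->
  (0 < k <= n)%N -> up k != 0.
Proof.
move=> Ae irr /andP[k0 le_kn]; apply/eqP => up0.
pose U := <<take k e>>%VS.
have size_tk : size (take k e) = k by rewrite size_take size_tuple ltnS le_kn.
have eU i : (i < k)%N -> e`_i \in U.
  by move=> ik; rewrite -(nth_take 0 ik) memv_span // mem_nth // size_tk.
have stab (Y : 'End(V)) : (forall i, (i < k)%N -> Y e`_i \in U) -> (Y @: U <= U)%VS.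
  move=> YU; rewrite /U limg_span; apply/span_subvP => _ /mapP[v /(nthP 0)[i + <-] ->].
  by rewrite size_tk => ik; rewrite nth_take // YU.
have AU : (A @: U <= U)%VS.
  apply: stab => i ik; rewrite Ae; last by lia.
  by rewrite memvZ // eU.
have XU : (X @: U <= U)%VS.
  apply: stab => i ik; rewrite X_tri; last by lia.
  rewrite !memvD //.
  - have [->|ik1] := eqVneq i.+1 k; first by rewrite up0 scale0r mem0v.
    by rewrite memvZ // eU // ltn_neqAle ik1.
  - by rewrite memvZ // eU.
  by case: i ik => [|i] ik; rewrite ?mem0v // memvZ // eU // ltnW.
have [U0|U1] := irr U AU XU.
  have := eU 0%N k0; rewrite U0 memv0 => /eqP e0.
  have := coord_tuple_nth ord0 (leq0n n); rewrite e0 linear0 => /eqP.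
  by rewrite eq_sym oner_eq0.
have := dim_span (take k e); rewrite -/U U1 size_tk.
by rewrite (size_basis e_basis) leqNgt ltnS le_kn.
Qed.

End Tridiagonal.

(** * Bethe states of a Leonard pair *)

Section LeonardSystem.
Variables (F : fieldType) (P : params F) (V : vectType F) (A As : 'End(V)).
Variable e : (p2s P).+1.-tuple V.
Local Notation q := (pq P).

(** Packaged so that the results below apply to A, [As] with [P] and again to [As], A with
    [invp P]. *)
Record leonard_system : Prop := LeonardSystem {
  ls_generic : generic P;
  ls_aw : askey_wilson_relations P A As;
  ls_eigen : eigenbasis A (theta P) e;
  ls_tri : tridiagonal_action As (coef_up P) (coef_diag P) (coef_down P) e;
  ls_irr : act_irreducibly A As }.

Definition top_up k : F :=
  (rho P)^-1 * (q * theta P k.-1 - q^-1 * theta P k) * coef_up P k.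
Definition top_down k : F :=
  (rho P)^-1 * (q * theta P k - q^-1 * theta P k.-1) * coef_down P k.

Hypothesis L : leonard_system.
Let G : generic P := ls_generic L.
Local Notation T := (Top P A As).

(** With x = q^(2i) and y = q^(2j), the difference theta_j - theta_i is (x - y)(c - b x y) / (x y),
    and genericity excludes the second factor since i + j <= 4s. *)
Lemma theta_inj i j : (i <= p2s P)%N -> (j <= p2s P)%N ->
  theta P i = theta P j -> i = j.
Proof.
move=> le_i le_j; have q0 := generic_q0 G.
rewrite !thetaE //; move=> E; apply: (expq_inj G); apply/eqP; rewrite -subr_eq0.
have := @generic_cb _ _ G (i + j)%N; rewrite mul2n -addnn leq_add // exprD => /(_ isT).
move: ((q ^+ 2) ^+ i) ((q ^+ 2) ^+ j) (expf_neq0 i (expf_neq0 2 q0))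
  (expf_neq0 j (expf_neq0 2 q0)) E => x y x0 y0 E cb.
have /eqP : (x - y) * (pc P - pb P * (x * y)) = 0.
  transitivity (x * y * (pb P * y + pc P * y^-1 - (pb P * x + pc P * x^-1))).
    by field; rewrite x0 y0.
  by rewrite E subrr mulr0.
by rewrite mulf_eq0 (negPf cb) orbF.
Qed.

Lemma A_nth k : A e`_k = theta P k *: e`_k.
Proof.
have [_ Ae] := ls_eigen L; have [le_k|lt_k] := leqP k (p2s P); first exact: Ae.
by rewrite nth_default ?size_tuple // linear0 scaler0.
Qed.

Lemma Top_tridiagonal : tridiagonal_action T top_up (top_diag P) top_down e.
Proof.
move=> k le_k; rewrite TopE A_nth linearZ /= (ls_tri L) //.
apply: coord_inj => i.
case: k le_k => [|k] le_k; rewrite ?addr0 !(linearB, linearD, linearZ) /= !A_nth.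
  rewrite !linearZ /= /GRing.scale /= /top_up /top_diag /=. ring.
rewrite !linearZ /= /GRing.scale /= /top_up /top_diag /top_down /=; ring.
Qed.

(** In q theta_k - q^-1 theta_(k+1) the terms in b cancel, which leaves a single power of q. *)
Lemma top_upE k :
  top_up k.+1 = - coef_up P k.+1 / (pb P * (q ^+ 2 - q ^- 2) * (q ^+ 2) ^+ k * q).
Proof.
have := (generic_q0 G, generic_b0 G, generic_c0 G, generic_q41 G) => -[[[q0 b0] c0] e2].
rewrite /top_up /= !thetaE // !(exprS (q ^+ 2)) /rho; have := expf_neq0 k (expf_neq0 2 q0).
move: ((q ^+ 2) ^+ k) (coef_up _ _) => y x y0; field.
by rewrite q0 y0 e2 b0 oppr_eq0 mulf_neq0.
Qed.

(** Obtained from irreducibility, because [generic] does not control the two factors of [coef_up]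
    that contain zeta. *)
Lemma coef_up_neq0 k : (0 < k <= p2s P)%N -> coef_up P k != 0.
Proof.
have [e_basis Ae] := ls_eigen L.
exact: (@irreducible_up_neq0 _ _ _ _ _ _ _ _ e_basis (ls_tri L) _ _ _ Ae (ls_irr L)).
Qed.

Lemma top_up_neq0 k : (0 < k <= p2s P)%N -> top_up k != 0.
Proof.
have := (generic_q0 G, generic_b0 G) => -[q0 b0].
case: k => // k le_k; rewrite top_upE mulf_neq0 ?oppr_eq0 ?coef_up_neq0 //.
by rewrite invr_eq0 !mulf_neq0 ?expf_neq0 ?(generic_q2V G).
Qed.

(** Here the factors with zeta are those that [generic] keeps nonzero for the denominators of the
    q-Racah polynomials. *)
Lemma coef_down_neq0 k : (0 < k <= p2s P)%N -> coef_down P k != 0.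
Proof.
have := (generic_q0 G, generic_b0 G, generic_c0 G, generic_cs0 G) => -[[[q0 b0] c0] cs0].
case: k => // k; rewrite /= => lt_k.
have [_ _ _ _ /(_ _ lt_k) [g1 g2]] := G.
have Y : q ^+ (p2s P + 1 + 2 * k) = (q ^+ 2) ^+ k * q ^+ p2s P * q.
  by rewrite (exprD _ _ (2 * k)) (exprD _ _ 1) expr1 (exprM _ 2 k); ring.
rewrite {}Y in g1 g2; rewrite coef_downE // exprS.
have k_s2 : (q ^+ 2) ^+ p2s P - (q ^+ 2) ^+ k != 0.
  by rewrite subr_eq0; apply: contraTneq lt_k => /(expq_inj G) ->; rewrite ltnn.
have c1 := @generic_cb _ _ G k ltac:(lia).
have c2 := @generic_cb _ _ G (2 * k) ltac:(lia); rewrite mulnC exprM in c2.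
have c3 := @generic_cb _ _ G (2 * k).+1 ltac:(lia); rewrite exprS mulnC exprM in c3.
have q2s0 := expf_neq0 (p2s P) (expf_neq0 2 q0).
have z0 := generic_z0 G.
move: ((q ^+ 2) ^+ k) ((q ^+ 2) ^+ p2s P) (q ^+ p2s P) g1 g2 c1 c2 c3 k_s2 q2s0.
move=> Y Q2 Q g1 g2 c1 c2 c3 k_s2 q2s0.
have -> : ((1 - q ^+ 2 * Y / Q2 / q ^+ 2) * (pc P - pb P * (q ^+ 2 * Y / q ^+ 2)) *
  (pc P + pbs P * pz P ^- 2 * (q ^+ 2 * Y * Q / q)) *
  (pcs P + pb P * pz P ^+ 2 * (q ^+ 2 * Y * Q / q))) /
  ((pc P - pb P * ((q ^+ 2 * Y) ^+ 2 / q ^+ 4)) * (pc P - pb P * ((q ^+ 2 * Y) ^+ 2 / q ^+ 2)))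
  = (Q2 - Y) / Q2 * (pc P - pb P * Y)
    * (pc P * (1 + pbs P / pc P * (Y * Q * q) * pz P ^- 2))
    * (pcs P * (1 + pb P / pcs P * (Y * Q * q) * pz P ^+ 2))
   / ((pc P - pb P * Y ^+ 2) * (pc P - pb P * (q ^+ 2 * Y ^+ 2))).
  field; rewrite q2s0 q0 c2 cs0 z0 c0 !andbT.
  by rewrite (_ : (q * Y) ^+ 2 = q ^+ 2 * Y ^+ 2) // exprMn.
by rewrite !mulf_neq0 ?invr_eq0 ?mulf_neq0.
Qed.

Lemma top_down_neq0 k : (0 < k <= p2s P)%N -> top_down k != 0.
Proof.
have := (generic_q0 G, generic_b0 G, generic_q41 G) => -[[q0 b0] e2].
have rho0 := generic_rho G.
case: k => // k le_k; rewrite /top_down mulf_neq0 ?coef_down_neq0 // mulf_neq0 ?invr_eq0 //=.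
rewrite !thetaE // exprS; have := expf_neq0 k (expf_neq0 2 q0).
move: ((q ^+ 2) ^+ k) => y y0.
rewrite [X in X != 0](_ : _ = pb P * y * ((q * q) ^+ 2 - 1) / q).
  by rewrite !mulf_neq0 ?invr_eq0.
by field; rewrite q0 y0.
Qed.

Definition bethe_poly M (u : M.-tuple F) : {poly F} :=
  \prod_(i < M) ('X - (xroot P (tnth u i))%:P).

Lemma bethe_poly_monic M (u : M.-tuple F) : bethe_poly u \is monic.
Proof. exact: monic_prod_XsubC. Qed.

Lemma size_bethe_poly M (u : M.-tuple F) : size (bethe_poly u) = M.+1.
Proof. by rewrite /bethe_poly size_prod_XsubC /index_enum -enumT size_enum_ord. Qed.

Lemma bethe_eigenvector M (u : M.-tuple F) : (M <= p2s P)%N ->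
  bethe_solution P false u ->
  A (poly_act T (bethe_poly u) e`_0) = theta P M *: poly_act T (bethe_poly u) e`_0.
Proof.
have q0 := generic_q0 G; have q1 := generic_qq1 G; have rho0 := generic_rho G.
(* M = 0 is separate: the spin may be zero then, whereas [shift_point_xroot] needs 2s > 0. *)
case: M u => [|M] u le_M sol_u.
  by rewrite /bethe_poly big_ord0 poly_act1 A_nth.
have T0 := Top_tridiagonal (leq0n (p2s P)); rewrite addr0 in T0.
apply: (@spectral_transform _ _ A T e`_0 (theta P) (tau P) (q ^+ 2 + q ^- 2)
  (Defs.eta P / rho P * (q - q^-1)) (- (eta_star P / rho P))).
- exact: A_nth.
- rewrite T0; apply: coord_inj => i.
  rewrite !(linearD, linearZ) /= !A_nth !(linearD, linearZ) /= /GRing.scale /=.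
  by rewrite /tau /top_diag; ring.
- exact: A_Top_Top q0 q1 rho0 (ls_aw L).
- by move=> k; exact: theta_rec.
- move=> i j; have [_ adm _ _] := sol_u; apply: contra_eq => ij.
  exact: xroot_inj_USym (adm i j ij).
move=> i; have [nt _ bq0 _] := sol_u; have [u0 _] := nt i.
do 4 eexists; split.
  by apply: shift_point_xroot; rewrite ?(leq_trans _ le_M) ?u0 ?bq0.
exact: (bethe_shift G sol_u i).
Qed.

(** The spectrum of A is simple, so the eigenvector is a multiple of e_M. The multiple is its
    coordinate M, which only the leading term of the polynomial reaches. *)
Lemma bethe_ket M (u : M.-tuple F) : (M <= p2s P)%N -> bethe_solution P false u ->
  poly_act T (bethe_poly u) e`_0 = (\prod_(k < M) top_up k.+1) *: e`_M.
Proof.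
move=> le_M sol_u; have [e_basis Ae] := ls_eigen L.
have lt_M : (M < (p2s P).+1)%N by [].
have := @eigenvector_expand _ _ _ _ e_basis A (theta P) (Ordinal lt_M) _ Ae theta_inj
  (bethe_eigenvector le_M sol_u).
rewrite (coord_poly_act_up e_basis Top_tridiagonal) //; first exact: bethe_poly_monic.
exact: size_bethe_poly.
Qed.

Lemma prod_top_up_neq0 M : (M <= p2s P)%N -> \prod_(k < M) top_up k.+1 != 0.
Proof.
move=> le_M; rewrite prodf_seq_neq0; apply/allP => k _ /=.
by rewrite top_up_neq0 //= (leq_trans (ltn_ord k)).
Qed.

(** Tested on e_k. For k > N the degree is too small to come down to e_0; for k = N the leading term
    gives the product; for k < N a Bethe polynomial of degree k reduces the claim to the first
    case. *)
Lemma bethe_bra (phi : V -> F) N (v : N.-tuple F) x : scalar phi ->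
  (forall i, (0 < i <= p2s P)%N -> phi e`_i = 0) ->
  (forall M, (M <= p2s P)%N -> exists u : M.-tuple F, bethe_solution P false u) ->
  (N <= p2s P)%N -> bethe_solution P false v ->
  phi (poly_act T (bethe_poly v) x)
  = (\prod_(k < N) top_down k.+1) * phi e`_0 * coord e (inord N) x.
Proof.
move=> phi_lin phi0 sols le_N sol_v; have [e_basis _] := ls_eigen L.
have phiZ a y : phi (a *: y) = a * phi y.
  have phi_0 : phi 0 = 0 by move: (phi_lin (-1) 0 0); rewrite scaler0 addr0 mulN1r addNr.
  by rewrite -[a *: y]addr0 phi_lin phi_0 addr0.
have phi_nth k : (k <= p2s P)%N -> phi (poly_act T (bethe_poly v) e`_k)
    = (k == N)%:R * (\prod_(i < N) top_down i.+1 * phi e`_0).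
  have down := @functional_poly_act_down _ _ _ _ _ _ _ _ Top_tridiagonal phi.
  move=> le_k; case: (ltngtP k N) => [lt_kN|lt_Nk|->] /=.
  (* Polynomials in T commute, so k and N can be exchanged. *)
  - have [u sol_u] := sols k le_k; rewrite mul0r.
    apply: (mulfI (prod_top_up_neq0 le_k)); rewrite mulr0.
    have /(congr1 phi) : (\prod_(i < k) top_up i.+1) *: poly_act T (bethe_poly v) e`_k
        = (\prod_(i < N) top_up i.+1) *: poly_act T (bethe_poly u) e`_N.
      transitivity (poly_act T (bethe_poly v) (poly_act T (bethe_poly u) e`_0)).
        by rewrite (bethe_ket le_k sol_u) linearZ.
      by rewrite -poly_actM mulrC poly_actM (bethe_ket le_N sol_v) linearZ.
    rewrite !phiZ => ->; rewrite down ?bethe_poly_monic ?size_bethe_poly // 1?ltnW //.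
    by rewrite eqSS (ltn_eqF lt_kN) /= mulr0n !mul0r mulr0.
  - rewrite down ?bethe_poly_monic ?size_bethe_poly // ?ltnS 1?ltnW //.
    by rewrite eqSS (ltn_eqF lt_Nk) /= mulr0n !mul0r.
  by rewrite down ?bethe_poly_monic ?size_bethe_poly // eqxx !mul1r.
rewrite {1}(tuple_expand e_basis x) linear_sum.
under eq_bigr do rewrite linearZ.
rewrite scalar_sum // (bigD1 (inord N)) //= inordK ?ltnS // phi_nth // eqxx mul1r.
rewrite [X in _ + X]big1 => [|i iN]; first by rewrite addr0 mulrC.
have le_i : (i <= p2s P)%N by rewrite -ltnS.
have /negPf iN' : i != N :> nat by apply: contraNneq iN => <-; rewrite inord_val.
by rewrite phi_nth // iN' mul0r mulr0.
Qed.

End LeonardSystem.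

(** * The exchange of A and [As] combined with the inversion of q *)

Section Inversion.
Variables (F : fieldType) (P : params F).
Local Notation q := (pq P).
Local Notation b := (pb P).
Local Notation c := (pc P).
Local Notation bs := (pbs P).
Local Notation cs := (pcs P).
Local Notation z := (pz P).

(* The parameters attached to the pair (A*, A) once q is replaced by q^-1. *)
Definition invp : params F := Params q^-1 cs bs c b z^-1 (p2s P).

Lemma theta_invp n : theta invp n = theta_star P n.
Proof. by rewrite /theta_star /theta /= !exprz_inv opprK addrC. Qed.

Lemma theta_star_invp n : theta_star invp n = theta P n.
Proof. by rewrite /theta_star /theta /= !exprz_inv opprK addrC. Qed.

Hypothesis G : generic P.
Let q0 : q != 0 := generic_q0 G.
Let qV0 : q^-1 != 0. Proof. by rewrite invr_eq0. Qed.

Lemma pbcE : b * c = bs * cs. Proof. by case: G. Qed.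

Lemma rho_invp : rho invp = rho P.
Proof. by rewrite /rho /= pbcE !exprVn invrK [cs * bs]mulrC -opprB sqrrN. Qed.

Lemma omega_invp : omega invp = omega P.
Proof.
rewrite /omega /= !(expzE q0) !(expzE qV0) !exprVn pbcE.
have := (generic_z0 G, expf_neq0 (p2s P) q0) => -[z0 Q0].
move: (q ^+ p2s P) Q0 => Q Q0; field. by rewrite q0 Q0 z0 oner_neq0.
Qed.

Lemma eta_invp : Defs.eta invp = eta_star P.
Proof.
rewrite /eta_star /Defs.eta /= !(expzE q0) !(expzE qV0) !exprVn.
have := (generic_z0 G, expf_neq0 (p2s P) q0, generic_q21 G) => -[[z0 Q0] h].
move: (q ^+ p2s P) Q0 => Q Q0; field.
by rewrite q0 Q0 z0 h oner_neq0.
Qed.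

Lemma eta_star_invp : eta_star invp = Defs.eta P.
Proof.
rewrite /eta_star /Defs.eta /= !(expzE q0) !(expzE qV0) !exprVn.
have := (generic_z0 G, expf_neq0 (p2s P) q0, generic_q21 G) => -[[z0 Q0] h].
move: (q ^+ p2s P) Q0 => Q Q0; field.
by rewrite q0 Q0 z0 h oner_neq0.
Qed.

(* Unlike the field tactic, this needs no hypothesis on the denominators. *)
Lemma eq_div_scaled (m n1 d1 n2 d2 : F) : m != 0 ->
  n1 = m * n2 -> d1 = m * d2 -> n1 / d1 = n2 / d2.
Proof. by move=> m0 -> ->; rewrite -mulf_div divff // mul1r. Qed.

Lemma coef_up_invp n : coef_up invp n = coef_up (dualp P) n.
Proof.
rewrite !coef_upE //=.
have := (generic_z0 G, expf_neq0 (p2s P) q0) => -[z0 Q0].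
rewrite !exprVn !(exprAC _ 2 (p2s P)); have := expf_neq0 n (expf_neq0 2 q0).
move: (q ^+ p2s P) ((q ^+ 2) ^+ n) Q0 => Q y Q0 y0.
(* The two denominator factors bs - cs / w of [invp] are -(cs - bs w) / w for w = y^2 / q^2 and w =
   y^2, whence this scalar. *)
apply: (@eq_div_scaled (q ^+ 2 / y ^+ 4)).
- by rewrite mulf_neq0 ?invr_eq0 ?expf_neq0.
- by field; rewrite ?q0 ?Q0 ?z0 ?y0 ?oner_neq0.
by field; rewrite ?q0 ?Q0 ?z0 ?y0 ?oner_neq0.
Qed.

Lemma coef_down_invp n : coef_down invp n = coef_down (dualp P) n.
Proof.
rewrite !coef_downE //=.
have := (generic_z0 G, expf_neq0 (p2s P) q0) => -[z0 Q0].
rewrite !exprVn !(exprAC _ 2 (p2s P)); have := expf_neq0 n (expf_neq0 2 q0).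
move: (q ^+ p2s P) ((q ^+ 2) ^+ n) Q0 => Q y Q0 y0.
apply: (@eq_div_scaled (q ^+ 6 / y ^+ 4)).
- by rewrite mulf_neq0 ?invr_eq0 ?expf_neq0.
- by field; rewrite ?q0 ?Q0 ?z0 ?y0 ?oner_neq0.
by field; rewrite ?q0 ?Q0 ?z0 ?y0 ?oner_neq0.
Qed.

Lemma coef_diag_invp n : coef_diag invp n = coef_diag (dualp P) n.
Proof.
rewrite /coef_diag coef_up_invp coef_down_invp theta_star_invp.
by rewrite /theta_star.
Qed.

Lemma generic_invp : generic invp.
Proof.
have [nz unit_q bc_eq cb_neq g] := G.
split=> /=.
- case: nz => -[? ? ? ? ?] ?; rewrite !invr_eq0; by split.
- by move=> k k0; rewrite exprVn invr_eq1 unit_q.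
- by rewrite mulrC -bc_eq mulrC.
- move=> k /cb_neq [c1 c2].
  have qk0 : q ^+ (2 * k) != 0 by rewrite expf_neq0.
  by rewrite exprVn; split; [apply: contraNneq c2 | apply: contraNneq c1] => ->;
    rewrite divfK.
move=> k /g [].
(* The inversion replaces t by 1 / t in the conditions 1 + t != 0, and 1 + t = t (1 + 1 / t). *)
have nonzero (x y t : F) : x != 0 -> y != 0 -> t != 0 ->
    1 + x / y * t != 0 -> 1 + y / x * t^-1 != 0.
  move=> x0 y0 t0; apply: contraNneq => E; apply/eqP.
  transitivity (x / y * t * (1 + y / x * t^-1)); last by rewrite E mulr0.
  by field; rewrite x0 y0 t0.
have := (generic_b0 G, generic_c0 G, generic_bs0 G, generic_cs0 G, generic_z0 G).
move=> [[[[b0 c0] bs0] cs0] z0].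
have qk0 : q ^+ (p2s P + 1 + 2 * k) != 0 by rewrite expf_neq0.
rewrite /= !exprVn invrK; move: (q ^+ _) (z ^+ 2) qk0 (expf_neq0 2 z0) => x y x0 y0 g1 g2.
split.
  have := @nonzero b cs (x * y) b0 cs0; rewrite mulf_neq0 // [b / cs * _]mulrA => /(_ isT g1).
  by rewrite invfM mulrA.
have := @nonzero bs c (x / y) bs0 c0; rewrite mulf_neq0 ?invr_eq0 // [bs / c * _]mulrA.
by move=> /(_ isT g2); rewrite invfM invrK mulrA.
Qed.

Section Operators.
Variables (V : vectType F) (A As : 'End(V)).

Lemma qcommV r (X Y : 'End(V)) : qcomm r^-1 Y X = - qcomm r X Y.
Proof. by rewrite /qcomm invrK opprB. Qed.

Lemma askey_wilson_invp : askey_wilson_relations P A As ->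
  askey_wilson_relations invp As A.
Proof.
(* The double q-commutator is symmetric under q -> q^-1, so the inversion preserves the relations
   and the exchange of operators swaps them. *)
have qqC r (X Y : 'End(V)) : qcomm r^-1 X (qcomm r X Y) = qcomm r X (qcomm r^-1 X Y).
  rewrite /qcomm !invrK; apply/lfunP => v; apply: coord_inj => i.
  rewrite !(add_lfunE, opp_lfunE, scale_lfunE, comp_lfunE).
  by rewrite !(linearD, linearN, linearZ) /= /GRing.scale /=; ring.
case=> E1 E2; split=> /=.
  by rewrite invrK -qqC E2 rho_invp omega_invp eta_invp.
by rewrite invrK -qqC E1 rho_invp omega_invp eta_star_invp.
Qed.

(** [A, As]_(q^-1) = -[As, A]_q, and q - q^-1 changes sign as well. *)
Lemma Top_invp : Top invp As A = - Top P A As.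
Proof.
rewrite /Top /= rho_invp omega_invp qcommV.
have -> : omega P / (q^-1 - q^-1^-1) = - (omega P / (q - q^-1)).
  by rewrite invrK -(opprB q) invrN mulrN.
by rewrite -scalerN [in RHS]opprD scaleNr.
Qed.

Lemma leonard_system_invp (es : (p2s P).+1.-tuple V) :
  askey_wilson_relations P A As -> eigenbasis As (theta_star P) es ->
  tridiagonal_action A (coef_up (dualp P)) (coef_diag (dualp P))
    (coef_down (dualp P)) es ->
  act_irreducibly A As -> @leonard_system _ invp V As A es.
Proof.
move=> AW [es_basis Ases] tri irr; split.
- exact: generic_invp.
- exact: askey_wilson_invp.
- by split=> // k /Ases; rewrite theta_invp.
- move=> k /tri ->; rewrite coef_up_invp coef_diag_invp.
  by case: k => // k; rewrite coef_down_invp.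
by move=> U sA sAs; apply: irr.
Qed.

End Operators.

Lemma xroot_invp (u : F) : xroot invp u^-1 = - xroot P u.
Proof.
by rewrite /xroot /= !exprVn !invrK -(opprB (q ^+ 2)) invrN mulrN [_ + q * _]addrC.
Qed.

(** b is odd under inversion, so [fBethe] and [hBethe] are unchanged, and the Lambda functions of
    sign - for [invp P] at 1/u are those of sign + for [P] at u. *)
Lemma bethe_solution_invp N (v : N.-tuple F) : bethe_solution P true v ->
  bethe_solution invp false [tuple of map (fun x => x^-1) v].
Proof.
have bV (x : F) : bfun x^-1 = - bfun x by rewrite /bfun invrK opprB.
case=> nt adm bq0 bethe.
have USymV (u : F) : USym invp u^-1 = USym P u.
  by rewrite /USym /= !exprVn !invrK addrC [_ + q]addrC.
split.
- move=> i; rewrite tnth_map; case: (nt i) => v0 vv; split; first by rewrite invr_eq0.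
  by rewrite exprVn invrK eq_sym.
- by move=> i j /adm; rewrite !tnth_map !USymV.
- by move=> i; rewrite tnth_map /= exprVn -invfM bV oppr_eq0.
move=> i; rewrite /EBethe tnth_map.
have v0 j : tnth v j != 0 by case: (nt j).
have := (generic_b0 G, generic_c0 G, generic_bs0 G, generic_cs0 G, generic_z0 G).
move=> [[[[b0 c0] bs0] cs0] z0]; have Q0 := expf_neq0 (p2s P) q0.
have L1 (u : F) : u != 0 -> Lambda1 invp false u^-1 = Lambda1 P true u.
  move=> u0; rewrite /Lambda1 /powsign /= !(expzE q0) !(expzE qV0) !exprVn !expr1 !expr0.
  rewrite (generic_bs G).
  by field; rewrite u0 b0 cs0 Q0 z0 q0 oner_neq0.
have L2 (u : F) : u != 0 -> bfun (q * u ^+ 2) != 0 -> Lambda2 invp false u^-1 = Lambda2 P true u.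
  move=> u0; rewrite bfun_eq0 ?mulf_neq0 ?expf_neq0 // => bu.
  rewrite /Lambda2 /powsign /= !(expzE q0) !(expzE qV0) !exprVn !expr1 !expr0 (generic_bs G).
  field; rewrite u0 b0 cs0 Q0 z0 q0 bu oner_neq0 /= mulNr -opprB oppr_eq0.
  by rewrite -expr2 bu.
have fV (u w : F) : fBethe invp u^-1 w^-1 = fBethe P u w.
  rewrite /fBethe /=.
  have -> : q^-1 * w^-1 / u^-1 = (q * w / u)^-1 by rewrite !invfM.
  have -> : w^-1 / u^-1 = (w / u)^-1 by rewrite !invfM.
  by rewrite -!invfM !bV !mulrNN.
have hV (u w : F) : hBethe invp u^-1 w^-1 = hBethe P u w.
  rewrite /hBethe /= exprVn.
  have -> : q^-1 * u^-1 / w^-1 = (q * u / w)^-1 by rewrite !invfM.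
  have -> : u^-1 / w^-1 = (u / w)^-1 by rewrite !invfM.
  by rewrite -!invfM !bV !mulrNN.
have [vi0 _] := nt i.
rewrite L1 // L2 // -[RHS](bethe i) /EBethe exprVn -invfM !bV invrN mulrNN.
by congr (_ * _ * _ + _ * _); apply: eq_bigr => j _; rewrite tnth_map ?fV ?hV.
Qed.

End Inversion.

(** * Finite q-Pochhammer symbols *)

Section QPochhammer.
Variables (F : fieldType) (p : F).

Lemma qpochhammer0 a : qpochhammer a p 0 = 1.
Proof. exact: big_ord0. Qed.

Lemma qpochhammerSr a k : qpochhammer a p k.+1 = qpochhammer a p k * (1 - a * p ^+ k).
Proof. exact: big_ord_recr. Qed.

Lemma qpochhammerSl a k : qpochhammer a p k.+1 = (1 - a) * qpochhammer (a * p) p k.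
Proof.
rewrite /qpochhammer big_ord_recl expr0 mulr1; congr (_ * _).
by apply: eq_bigr => i _; rewrite /bump /= exprS mulrA.
Qed.

Lemma qpochhammer_expV n k : p != 0 -> (n < k)%N -> qpochhammer (p ^+ n)^-1 p k = 0.
Proof.
move=> p0 lt_nk; rewrite /qpochhammer (bigD1 (Ordinal lt_nk)) //=.
by rewrite mulVf ?expf_neq0 // subrr mul0r.
Qed.

End QPochhammer.

(** * The difference equation of the q-Racah polynomials in N *)

Section QRacahRecurrence.
Variables (F : fieldType) (P : params F).
Hypothesis G : generic P.
Local Notation q := (pq P).
Local Notation b := (pb P).
Local Notation c := (pc P).
Local Notation bs := (pbs P).
Local Notation cs := (pcs P).
Local Notation z := (pz P).
Local Notation p := (pq P ^+ 2).
Local Notation Q := (pq P ^+ p2s P).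

Let d1 : F := - (b / cs * (Q * q) * z ^+ 2).
Let d2 : F := - (bs / c * (Q * q) * z ^- 2).
Let d3 : F := (p ^+ p2s P)^-1.

(** The N-dependent factor of the k-th summand at x = q^(2N): a polynomial of degree k in
    [theta_star P N]. *)
Definition racah_basis (k : nat) (x : F) : F :=
  qpochhammer x^-1 p k * qpochhammer (bs / cs * x) p k.

Definition racah_coef (M k : nat) : F :=
  qpochhammer (p ^+ M)^-1 p k * qpochhammer (b / c * p ^+ M) p k
  / (qpochhammer d1 p k * qpochhammer d2 p k * qpochhammer d3 p k * qpochhammer p p k)
  * p ^+ k.

Lemma racah_basis0 x : racah_basis 0 x = 1.
Proof. by rewrite /racah_basis !qpochhammer0 mulr1. Qed.

Lemma racah_basis_eq0 n k : (n < k)%N -> racah_basis k (p ^+ n) = 0.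
Proof.
by move=> nk; rewrite /racah_basis qpochhammer_expV ?mul0r ?expf_neq0 ?(generic_q0 G).
Qed.

(** A summation range independent of N lets shifts in N be compared term by term; the added terms
    vanish. *)
Lemma qRacahE M N : (M <= p2s P)%N -> (N <= p2s P)%N ->
  qRacah P M N = \sum_(k < (p2s P).+1) racah_coef M k * racah_basis k (p ^+ N).
Proof.
move=> le_M le_N; have q0 := generic_q0 G; have p0 := expf_neq0 2 q0.
rewrite /qRacah /phi43 !(expzE q0).
rewrite (big_ord_widen (p2s P).+1 (fun k =>
  (qpochhammer (p ^+ M)^-1 p k * qpochhammer (b / c * p ^+ M) p k *
   qpochhammer (p ^+ N)^-1 p k * qpochhammer (bs / cs * p ^+ N) p k) /
  (qpochhammer d1 p k * qpochhammer d2 p k *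
   qpochhammer d3 p k * qpochhammer p p k) * p ^+ k)); last first.
  by rewrite ltnS geq_min le_M.
rewrite big_mkcond; apply: eq_bigr => k _; rewrite /racah_coef /racah_basis ltnS.
case: ifPn => [_|]; first by ring.
rewrite -ltnNge gtn_min => /orP[] lt_k; rewrite (qpochhammer_expV p0 lt_k).
  by rewrite !mul0r.
by rewrite mul0r mulr0.
Qed.

(** Its factors cancel the new denominators of [racah_coef M k.+1]; it is also the off-diagonal
    entry in [racah_basis_step]. *)
Let mu k : F := - c / p ^+ k.+1 * (1 - d1 * p ^+ k) * (1 - d2 * p ^+ k)
  * (1 - d3 * p ^+ k) * (1 - p ^+ k.+1).

(** The two new numerator factors multiply to -(p^k / c) (theta_M - theta_k), and [mu k] absorbs the
    rest. *)
Lemma racah_coef_step M k : (k < p2s P)%N ->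
  racah_coef M k.+1 * mu k = racah_coef M k * (theta P M - theta P k).
Proof.
move=> lt_k; have q0 := generic_q0 G; have p0 := expf_neq0 2 q0.
have c0 := generic_c0 G.
have [_ _ _ _ /(_ _ lt_k) [g1 g2]] := G.
have e1 : 1 - d1 * p ^+ k != 0.
  apply: contraNneq g1 => E; apply/eqP; rewrite -[RHS]E /d1.
  by rewrite (exprD _ _ (2 * k)) (exprD _ _ 1) expr1 exprM; ring.
have e2 : 1 - d2 * p ^+ k != 0.
  apply: contraNneq g2 => E; apply/eqP; rewrite -[RHS]E /d2.
  by rewrite (exprD _ _ (2 * k)) (exprD _ _ 1) expr1 exprM; ring.
have e3 : 1 - d3 * p ^+ k != 0.
  rewrite subr_eq0; apply: contraTneq lt_k; rewrite /d3 => E.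
  suff /(expq_inj G) -> : p ^+ k = p ^+ p2s P by rewrite ltnn.
  by rewrite -[LHS](mulVKf (expf_neq0 (p2s P) p0)) -E mulr1.
have e4 : 1 - p * p ^+ k != 0.
  by rewrite -exprS -exprM -opprB oppr_eq0 (generic_expq G).
rewrite /racah_coef /mu !qpochhammerSr !thetaE // !(exprS p).
move: (qpochhammer d1 _ _) (qpochhammer d2 _ _) (qpochhammer d3 _ _).
move: (qpochhammer p _ _) (qpochhammer _ _ _) (qpochhammer _ _ _).
move: (d1) (d2) (d3) (p ^+ k) (p ^+ M) (expf_neq0 k p0) (expf_neq0 M p0) e1 e2 e3 e4.
move=> t1 t2 t3 y x y0 x0 e1 e2 e3 e4 D4 N1 N2 D1 D2 D3.
rewrite !invfM; move: (D1^-1) (D2^-1) (D3^-1) (D4^-1) => {D1 D2 D3 D4} D1 D2 D3 D4.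
by field; rewrite y0 c0 x0 q0 e1 e2 e3 e4.
Qed.

(** The difference operator is bidiagonal on [racah_basis]: every term is [racah_basis k x] times
    explicit factors, so a rational identity remains. *)
Lemma racah_basis_step k N : (N < p2s P)%N -> let x := p ^+ N in
  coef_up (dualp P) N * (racah_basis k.+1 (x / p) - racah_basis k.+1 x)
  + coef_down (dualp P) N.+1 * (racah_basis k.+1 (x * p) - racah_basis k.+1 x)
  = (theta P k.+1 - theta P 0) * racah_basis k.+1 x + mu k * racah_basis k x.
Proof.
move=> lt_N x; have q0 := generic_q0 G; have p0 := expf_neq0 2 q0.
have := (generic_b0 G, generic_c0 G, generic_bs0 G, generic_cs0 G, generic_z0 G).
move=> [[[[b0 c0] bs0] cs0] z0]; have Q0 := expf_neq0 (p2s P) q0.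
have x0 : x != 0 by rewrite expf_neq0.
have cs_neq n : (n <= 2 * p2s P)%N -> cs - bs * p ^+ n != 0.
  by move=> le_n; have [_ _ _ /(_ n le_n) [_ +] _] := G; rewrite exprM subr_eq0.
have s0 : cs - bs * x != 0 by apply: cs_neq; clear -lt_N; lia.
have s1 : cs - bs * x ^+ 2 != 0 by rewrite -exprM; apply: cs_neq; clear -lt_N; lia.
have s2 : cs - bs * (p * x ^+ 2) != 0.
  by rewrite -exprM -exprS; apply: cs_neq; clear -lt_N; lia.
have y0 := expf_neq0 k p0.
(* Splits off 1 - bs / cs x, the factor that [Bp] needs to express the shifted basis function; [Up]
   does the same with 1 - 1 / x for [Bm]. *)
have Dn : coef_down (dualp P) N.+1 = (1 - bs / cs * x) * ((1 - x / Q ^+ 2)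
   * (cs + b * z ^+ 2 * (x * Q * q)) * (c + bs * z ^- 2 * (x * Q * q))
   / ((cs - bs * x ^+ 2) * (cs - bs * (p * x ^+ 2))) * cs).
  rewrite coef_downE //= !exprVn invrK (exprAC q 2 (p2s P)) exprS -/x.
  move: (x) (Q) Q0 x0 s1 s2 => X Q' Q0 x0 s1 s2; field.
  by rewrite [(q * X) ^+ 2]exprMn s1 s2 z0 Q0 cs0 q0.
have Bp : (1 - bs / cs * x) * racah_basis k.+1 (x * p)
  = racah_basis k x * ((1 - (x * p)^-1) * (1 - bs / cs * x * p ^+ k)
      * (1 - bs / cs * x * (p * p ^+ k))).
  have E := qpochhammerSl p (bs / cs * x) k; rewrite qpochhammerSr in E.
  rewrite /racah_basis qpochhammerSl qpochhammerSr.
  have -> : (x * p)^-1 * p = x^-1 by rewrite invfM mulfVK.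
  rewrite [bs / cs * (x * p)]mulrA.
  transitivity ((1 - (x * p)^-1) * qpochhammer x^-1 p k
    * ((1 - bs / cs * x) * qpochhammer (bs / cs * x * p) p k)
    * (1 - bs / cs * x * p ^+ k * p)); first by ring.
  by rewrite -E; ring.
have B0 : racah_basis k.+1 x
   = racah_basis k x * ((1 - x^-1 * p ^+ k) * (1 - bs / cs * x * p ^+ k)).
  by rewrite /racah_basis !qpochhammerSr; ring.
have Bm : (1 - x^-1) * racah_basis k.+1 (x / p)
  = racah_basis k x * ((1 - x^-1 * p ^+ k) * (1 - x^-1 * (p * p ^+ k))
      * (1 - bs / cs * x / p)).
  have E := qpochhammerSl p x^-1 k; rewrite qpochhammerSr in E.
  rewrite /racah_basis (qpochhammerSl _ (bs / cs * (x / p))) qpochhammerSr invf_div.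
  rewrite [p / x]mulrC -[bs / cs * (x / p) * p]mulrA divfK //.
  transitivity ((1 - x^-1) * qpochhammer (x^-1 * p) p k * (1 - x^-1 * p * p ^+ k)
    * ((1 - bs / cs * (x / p)) * qpochhammer (bs / cs * x) p k)); first by ring.
  by rewrite -E; ring.
have thE : theta P k.+1 - theta P 0 = b * (p * p ^+ k) + c / (p * p ^+ k) - (b + c).
  by rewrite !thetaE // exprS expr0 mulr1 invr1 mulr1.
have muE : mu k = - c / (p * p ^+ k) * (1 - d1 * p ^+ k) * (1 - d2 * p ^+ k)
    * (1 - d3 * p ^+ k) * (1 - p * p ^+ k) by rewrite /mu exprS.
rewrite {}thE {}muE.
case: N @x lt_N x0 s0 s1 s2 Dn Bp B0 Bm => [|N] x lt_N x0 s0 s1 s2 Dn Bp B0 Bm.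
  (* Here coef_up has the factor 1 / (cs - bs q^-2), about which [generic] says nothing. *)
  rewrite coef_up0 mul0r add0r.
  (* At x = 1 and k > 0 all terms vanish, the shifted one through [Bp]. *)
  case: k y0 Dn Bp B0 Bm => [|k] y0 Dn Bp B0 Bm; last first.
    have rb0 j : racah_basis j.+1 x = 0 by apply: racah_basis_eq0.
    rewrite !rb0 subr0 !mulr0 addr0 Dn mulrAC Bp rb0 !mul0r //.
  rewrite mulrBr {1}Dn mulrAC Bp B0 racah_basis0 /d1 /d2 /d3 (exprAC q 2 (p2s P)).
  move: s0 s1 s2; rewrite /x !expr0 expr1n !mulr1 => s0 _ s2.
  by field; rewrite Q0 z0 c0 cs0 q0 oner_neq0 s2 s0.
have s3 : cs - bs * (x ^+ 2 / p) != 0.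
  have -> : x ^+ 2 / p = p ^+ (N * 2).+1.
    by rewrite /x -(exprM p) (_ : (N.+1 * 2 = (N * 2).+2)%N) // exprS mulrC mulKf.
  by apply: cs_neq; clear -lt_N; lia.
have Up : coef_up (dualp P) N.+1 = (1 - x^-1) * (- x * p / Q ^+ 2
   * ((cs - bs * (x * Q ^+ 2)) * (b * (Q / q) * z ^+ 2 + bs * (x / p))
   * (cs * (Q / q) * z ^- 2 + c * (x / p)))
  / ((cs - bs * (x ^+ 2 / p)) * (cs - bs * x ^+ 2))).
  rewrite coef_upE //= !exprVn invrK (exprAC q 2 (p2s P)) -/x.
  move: (x) (Q) Q0 x0 s1 s2 s3 => X Q' Q0 x0 s1 s2 s3; field.
  rewrite q0 s1 z0 Q0 x0 !andbT; apply: contraNneq s3 => E.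
  by apply/eqP; apply: (mulIf p0); rewrite mul0r -[RHS]E; field; rewrite q0.
move: (racah_basis k.+1 (x / p)) (racah_basis k.+1 (x * p)) Bm Bp Dn Up => Rm Rp Bm Bp Dn Up.
rewrite !mulrBr {1}Up {1}Dn.
rewrite [_ * _ * Rm]mulrAC Bm [_ * _ * Rp]mulrAC Bp B0 Up Dn /d1 /d2 /d3 (exprAC q 2 (p2s P)).
rewrite (generic_bs G) in s0 s1 s2 s3 *.
move: (p ^+ k) (racah_basis k x) (x) (Q) y0 x0 Q0 s0 s1 s2 s3 => {Bm Bp B0 Up Dn x}.
move=> y B x Qt y0 x0 Q0 s0 s1 s2 s3.
have csbc w : cs * cs - b * c * w = cs * (cs - b * c / cs * w) by field.
field; rewrite Q0 z0 c0 cs0 y0 q0 x0 [(q * x) ^+ 2]exprMn !csbc !mulf_neq0 //=.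
have -> : cs * (cs * p) - b * c * x ^+ 2 = cs * p * (cs - b * c / cs * (x ^+ 2 / p)).
  by field; rewrite cs0 q0.
by rewrite !mulf_neq0.
Qed.

(** Expand in [racah_basis]: the diagonal gives theta_k - theta_0, the off-diagonal terms give
    theta_M - theta_k by [racah_coef_step], and the sum no longer depends on k. *)
Lemma qRacah_recurrence M N : (M <= p2s P)%N -> (N < p2s P)%N ->
  coef_up (dualp P) N * (qRacah P M N.-1 - qRacah P M N)
  + coef_down (dualp P) N.+1 * (qRacah P M N.+1 - qRacah P M N)
  = (theta P M - theta P 0) * qRacah P M N.
Proof.
move=> le_M lt_N; have q0 := generic_q0 G; have p0 := expf_neq0 2 q0.
have le_N := ltnW lt_N; have le_N1 := leq_trans (leq_pred N) le_N.
pose x := p ^+ N; pose r x := \sum_(k < (p2s P).+1) racah_coef M k * racah_basis k x.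
(* At N = 0 the value of [N.-1] is harmless, because [coef_up] vanishes there. *)
have rN1 : coef_up (dualp P) N * qRacah P M N.-1 = coef_up (dualp P) N * r (x / p).
  case: N @x {lt_N le_N} le_N1 => [|N] x le_N1; first by rewrite coef_up0 !mul0r.
  by rewrite qRacahE // /x (exprSr p) mulfK.
rewrite mulrBr rN1 -mulrBr !qRacahE // -/x -/(r x).
have -> : \sum_(k < (p2s P).+1) racah_coef M k * racah_basis k (p ^+ N.+1) = r (x * p).
  by rewrite /x -exprSr.
transitivity (\sum_(k < p2s P) racah_coef M k.+1
   * ((theta P k.+1 - theta P 0) * racah_basis k.+1 x + mu k * racah_basis k x)).
  rewrite -!sumrB !mulr_sumr -big_split big_ord_recl /= !racah_basis0 !subrr !mulr0 !add0r.
  apply: eq_bigr => k _; rewrite /bump /= !add1n -racah_basis_step //.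
  by rewrite -/x; ring.
under eq_bigr => k _ do
  rewrite mulrDr (mulrA _ (mu k)) racah_coef_step // (mulrA _ (theta P k.+1 - _)).
rewrite big_split /= mulr_sumr.
(* Both sums are extended to the full range: the new term k = 0 has theta_0 - theta_0, and the new
   term k = 2s vanishes because N < 2s. *)
transitivity (\sum_(k < (p2s P).+1)
    racah_coef M k * (theta P k - theta P 0) * racah_basis k x
  + \sum_(k < (p2s P).+1)
    racah_coef M k * (theta P M - theta P k) * racah_basis k x).
  congr (_ + _); first by rewrite big_ord_recl subrr mulr0 mul0r add0r.
  by rewrite big_ord_recr /= (racah_basis_eq0 lt_N) mulr0 addr0.
by rewrite -big_split; apply: eq_bigr => k _ /=; ring.
Qed.

End QRacahRecurrence.

Lemma qRacah0 (F : fieldType) (P : params F) M : qRacah P M 0 = 1.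
Proof.
rewrite /qRacah /phi43 minn0 big_ord1 !qpochhammer0 !mulr1 invr1.
exact: mulr1.
Qed.

(** * Scalar products of Bethe states *)

Section Overlaps.
Variables (F : fieldType) (P : params F) (V : vectType F) (A As : 'End(V)).
Variables (e es : (p2s P).+1.-tuple V).
Variables (chi : F) (m0 : int).
Hypotheses (L : leonard_system A As e) (Ld : @leonard_system _ (invp P) _ As A es).
Hypothesis chi0 : chi != 0.
Let G : generic P := ls_generic L.
Let q0 : pq P != 0 := generic_q0 G.
Local Notation T := (Top P A As).
Local Notation Td := (Top (invp P) As A).
Local Notation q := (pq P).

Definition inv_tuple N (v : N.-tuple F) : N.-tuple F :=
  [tuple of map (fun x => x^-1) v].

Lemma calB_invp u : calB P A As chi u
  = (- (chi * bfun (u ^+ 2))) *: (Td - xroot (invp P) u^-1 *: \1%VF).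
Proof.
by rewrite calBE (Top_invp G) xroot_invp !scaleNr opprK -scalerN opprD !opprK.
Qed.

(** Only k != 0 matters: this ket occurs in a numerator and in a denominator, so k cancels. The same
    holds for the bra in [Psi_plus_leftE]. *)
Lemma Psi_minusE (alpha : F) M (u : M.-tuple F) : (M <= p2s P)%N -> alpha != 0 ->
  bethe_solution P false u ->
  exists2 k : F, k != 0 & Psi_minus P A As chi m0 alpha u e`_0 = k *: e`_M.
Proof.
move=> le_M alpha0 sol_u; have [nt _ _ _] := sol_u.
pose k (i : 'I_M) := alpha^-1 * q ^ (m0 + 2 * (M%:Z - 1 - i%:Z) + 2) * tnth u i
   * (chi * bfun (tnth u i ^+ 2)).
exists ((\prod_(i < M) k i) * \prod_(i < M) top_up P i.+1).
  rewrite mulf_neq0 ?(prod_top_up_neq0 L) // prodf_seq_neq0; apply/allP => i _ /=.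
  have [u0 u2] := nt i.
  by rewrite /k !mulf_neq0 ?invr_eq0 ?expfz_neq0 // subr_eq0.
rewrite -scalerA -(bethe_ket L le_M sol_u) -big_comp_poly_act /Psi_minus.
by congr (fun_of_lfun _ _); apply: eq_bigr => i _; rewrite /Bminus calBE scalerA.
Qed.

(** Kept explicit, since this ket occurs only once and its scale must match [norm_star]. *)
Definition plus_scalar (alpha : F) N (v : N.-tuple F) : F :=
  \prod_(i < N) (alpha^-1 * q ^ (- (m0 + 2 * (N%:Z - 1 - i%:Z)) - 2) * (tnth v i)^-1
    * - (chi * bfun (tnth v i ^+ 2))).

Lemma Psi_plusE (alpha : F) N (v : N.-tuple F) : (N <= p2s P)%N ->
  bethe_solution P true v ->
  Psi_plus P A As chi m0 alpha v es`_0
  = (plus_scalar alpha v * \prod_(k < N) top_up (invp P) k.+1) *: es`_N.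
Proof.
move=> le_N sol_v; have sol_iv := bethe_solution_invp G sol_v.
rewrite -scalerA -(bethe_ket Ld le_N sol_iv) -big_comp_poly_act /Psi_plus.
congr (fun_of_lfun _ _); apply: eq_bigr => i _.
by rewrite /Bplus calB_invp scalerA tnth_map.
Qed.

Lemma plus_scalarE (alpha : F) N (v : N.-tuple F) :
  (q ^+ 2 - q ^- 2) * chi^-1 * alpha * pcs P * q ^ m0 = 1 ->
  plus_scalar alpha v * \prod_(k < N) top_up (invp P) k.+1 = (norm_star P v)^-1.
Proof.
move=> Halpha; have p0 := expf_neq0 2 q0.
rewrite /norm_star -prodfV.
transitivity ((\prod_(i < N) (alpha^-1 * chi * q ^ (- m0) / q ^+ 2 / (q ^+ 2) ^+ (N - i.+1)))
  * (\prod_(i < N) - ((tnth v i)^-1 * bfun (tnth v i ^+ 2)))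
  * \prod_(k < N) top_up (invp P) k.+1).
  congr (_ * _); rewrite -big_split; apply: eq_bigr => i _ /=.
  have -> : - (m0 + 2 * (N%:Z - 1 - i%:Z)) - 2 = - m0 - 2 - 2 * (N - i.+1)%N%:Z :> int.
    by have := ltn_ord i; lia.
  rewrite !(expzE q0). ring.
(* Reversing the first product aligns its powers q^(-2i) with the opposite powers in [top_up]. *)
rewrite (reindex_inj rev_ord_inj) /= -!big_split; apply: eq_bigr => i _ /=.
have -> : (N - (N - i.+1).+1)%N = i by have := ltn_ord i; lia.
have [cs0 e2] : pcs P != 0 /\ (q * q) ^+ 2 - 1 != 0.
  by split; [exact: generic_cs0 G | exact: generic_q41 G].
have alpha0 : alpha != 0.
  by apply: contra_eq_neq Halpha => ->; rewrite mulr0 !mul0r eq_sym oner_eq0.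
have -> : alpha^-1 * chi * q ^ (- m0) = (q ^+ 2 - q ^- 2) * pcs P.
  apply: (mulIf (_ : chi^-1 * alpha * q ^ m0 != 0)).
    by rewrite !mulf_neq0 ?invr_eq0 ?expfz_neq0.
  rewrite (expzN _ m0); have qm0 : q ^ m0 != 0 by rewrite expfz_neq0.
  transitivity (1 : F); first by field; rewrite alpha0 chi0 qm0.
  by rewrite -Halpha; ring.
rewrite invrK (top_upE Ld) /= (coef_up_invp G) !exprVn invrK.
have := expf_neq0 i p0; move: ((q ^+ 2) ^+ i) (coef_up _ _) (tnth v i)^-1 (bfun _).
move=> y a w w' y0; field; rewrite q0 y0 cs0 mulNr -opprB oppr_eq0 /= andbT.
by rewrite -expr2 e2.
Qed.

Lemma norm_star_neq0 N (v : N.-tuple F) : (N <= p2s P)%N ->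
  bethe_solution P true v -> norm_star P v != 0.
Proof.
move=> le_N [nt _ _ _]; rewrite prodf_seq_neq0; apply/allP => k _ /=.
have [v0 v2] := nt k; rewrite invr_eq0 oppr_eq0 -(coef_up_invp G).
rewrite mulf_neq0 //; first by rewrite !mulf_neq0 ?invr_eq0 ?subr_eq0.
by apply: (coef_up_neq0 Ld); rewrite /= (leq_trans (ltn_ord k) le_N).
Qed.

Variable OmL : 'Hom(V, F^o).
Hypotheses (OmL0 : OmL != 0) (OmL_eigen : (OmL \o As)%VF = theta_star P 0 *: OmL).

Lemma OmL_scalar : scalar (OmL : V -> F).
Proof. by move=> a x y; rewrite linearP. Qed.

(** A left eigenvector kills right eigenvectors of other eigenvalues, and these are distinct by
    [theta_inj] for [invp P]. *)
Lemma OmL_nth k : (0 < k <= p2s P)%N -> OmL es`_k = 0.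
Proof.
case/andP=> k0 le_k; have [_ Ases] := ls_eigen Ld.
have /lfunP/(_ es`_k) := OmL_eigen; rewrite comp_lfunE scale_lfunE Ases // linearZ /=.
move/eqP; rewrite -subr_eq0 -scalerBl scaler_eq0 subr_eq0 => /orP[|/eqP //].
rewrite -theta_invp => /eqP /(theta_inj Ld le_k (leq0n _)) kk.
by rewrite kk in k0.
Qed.

Lemma OmLE x : OmL x = OmL es`_0 * coord es 0 x.
Proof.
have [es_basis _] := ls_eigen Ld.
rewrite {1}(tuple_expand es_basis x) (scalar_sum _ _ OmL_scalar) big_ord_recl.
rewrite big1 ?addr0 1?mulrC // => i _.
by rewrite lift0 OmL_nth ?mulr0 //= ltn_ord.
Qed.

Lemma OmL_0_neq0 : OmL es`_0 != 0.
Proof.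
apply: contraNneq OmL0 => E; apply/eqP/lfunP => x.
by rewrite OmLE E mul0r zero_lfunE.
Qed.

Lemma Psi_plus_leftE (beta : F) N (v : N.-tuple F) : beta != 0 -> (N <= p2s P)%N ->
  bethe_solution P true v ->
  (forall N : nat, (N <= p2s P)%N -> exists w : N.-tuple F, bethe_solution P true w) ->
  exists2 k : F, k != 0 & forall x,
    Psi_plus_left P A As chi m0 beta v OmL x = k * coord es (inord N) x.
Proof.
move=> beta0 le_N sol_v sols; have [nt _ _ _] := sol_v.
have sol_iv := bethe_solution_invp G sol_v.
pose k (i : 'I_N) := beta^-1 * q ^ (m0 + 2 * (i%:Z + 1) - 2) * (tnth v i)^-1
   * - (chi * bfun (tnth v i ^+ 2)).
exists ((\prod_(i < N) k i) * ((\prod_(i < N) top_down (invp P) i.+1) * OmL es`_0)).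
  rewrite !mulf_neq0 ?OmL_0_neq0 // prodf_seq_neq0; apply/allP => i _ /=.
    have [u0 u2] := nt i.
    by rewrite /k !mulf_neq0 ?oppr_eq0 ?mulf_neq0 ?invr_eq0 ?expfz_neq0 // subr_eq0.
  by rewrite (top_down_neq0 Ld) //= (leq_trans (ltn_ord i)).
move=> x; rewrite -mulrA -(bethe_bra Ld x OmL_scalar OmL_nth _ le_N sol_iv); last first.
  move=> M /sols [w sol_w]; exists (inv_tuple w); exact: bethe_solution_invp.
rewrite /Psi_plus_left comp_lfunE.
transitivity (OmL ((\prod_(i < N) k i) *: poly_act Td (bethe_poly (invp P) (inv_tuple v)) x)).
  rewrite -big_comp_poly_act; congr (OmL (fun_of_lfun _ _)); apply: eq_bigr => i _.
  by rewrite /Cplus calB_invp scalerA tnth_map.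
by rewrite linearZ.
Qed.

Hypothesis tri_es : tridiagonal_action A (coef_up (dualp P)) (coef_diag (dualp P))
  (coef_down (dualp P)) es.

(** The coordinates of A e_M = theta_M e_M obey the recurrence of [qRacah], whose value at N = 0 is
    1; a nonzero [coef_down] determines each next coordinate. *)
Lemma coord_ket M N : (M <= p2s P)%N -> (N <= p2s P)%N ->
  coord es (inord N) e`_M = coord es 0 e`_M * qRacah P M N.
Proof.
move=> le_M; have [es_basis _] := ls_eigen Ld.
have rec n : (n < p2s P)%N ->
  (theta P M - theta P 0) * coord es (inord n) e`_M
  = coef_up (dualp P) n * (coord es (inord n.-1) e`_M - coord es (inord n) e`_M)
  + coef_down (dualp P) n.+1 * (coord es (inord n.+1) e`_M - coord es (inord n) e`_M).
  move=> lt_n.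
  have nK : nat_of_ord (inord n : 'I_(p2s P).+1) = n.
    by apply: inordK; apply: ltnW.
  have := @coord_tridiagonal _ _ _ _ _ _ _ _ es_basis tri_es (inord n) e`_M.
  rewrite nK => /(_ lt_n); rewrite (A_nth L) linearZ /= /coef_diag => E.
  rewrite mulrBl E; change (theta_star (dualp P) 0) with (theta P 0).
  by case: n {lt_n nK E} => [|n] /=; rewrite ?coef_up0; ring.
have c0 : inord 0 = 0 :> 'I_(p2s P).+1 by apply: val_inj; rewrite /= inordK.
(* The recurrence has order two, so the induction carries two consecutive coordinates. *)
suff: forall n, (n <= p2s P)%N ->
    coord es (inord n.-1) e`_M = coord es 0 e`_M * qRacah P M n.-1
    /\ coord es (inord n) e`_M = coord es 0 e`_M * qRacah P M n.
  by move=> H /H [].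
elim=> [|n IHn] lt_n; first by rewrite /= c0 qRacah0 mulr1.
have [IH1 IH0] := IHn (ltnW lt_n); split=> //=.
have d0 : coef_down (dualp P) n.+1 != 0.
  by rewrite -(coef_down_invp G) (coef_down_neq0 Ld).
apply: (addIr (- coord es (inord n) e`_M)); apply: (mulfI d0).
apply: (addrI (coef_up (dualp P) n
  * (coord es (inord n.-1) e`_M - coord es (inord n) e`_M))).
rewrite -rec // IH1 IH0 -mulrBr.
by rewrite mulrCA -(qRacah_recurrence G) //; ring.
Qed.

(** Otherwise [coord_ket] would make every coordinate of e_M vanish. *)
Lemma coord0_ket_neq0 M : (M <= p2s P)%N -> coord es 0 e`_M != 0.
Proof.
move=> le_M; have [es_basis _] := ls_eigen Ld; have [e_basis _] := ls_eigen L.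
apply/eqP => E; have lt_M : (M < (p2s P).+1)%N by [].
have := coord_tuple_nth e_basis (Ordinal lt_M) le_M.
rewrite (tuple_expand es_basis e`_M) big1 ?linear0 ?eqxx => [/esym/eqP|i _].
  by rewrite oner_eq0.
have le_i : (i <= p2s P)%N by rewrite -ltnS.
by rewrite -[X in coord _ X](inord_val i) coord_ket // E mul0r scale0r.
Qed.

End Overlaps.

(** * The q-Racah polynomials as ratios of scalar products *)

Theorem proposition3p1 (R : realType) (P : params R[i]) (V : vectType R[i])
  (A As : 'End(V))
  (* the eigenbases |theta_M> of A and |theta*_N> of A* *)
  (e es : (p2s P).+1.-tuple V)
  (* the left reference state <Omega^+| = <theta*_0| *)
  (OmL : 'Hom(V, R[i]^o))
  (chi : R[i]) (m0 : int) (alpha_minus alpha_plus beta_plus : R[i])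
  (Hgen : generic P)
  (Hdim : \dim {:V} = (p2s P).+1)
  (HdiagA : diagonalizable_end A) (HdiagAs : diagonalizable_end As)
  (HmfA : multiplicity_free A) (HmfAs : multiplicity_free As)
  (HspA : spectrum_is A (p2s P) (theta P))
  (HspAs : spectrum_is As (p2s P) (theta_star P))
  (Hirr : act_irreducibly A As)
  (HAW : askey_wilson_relations P A As)
  (He : eigenbasis A (theta P) e)
  (Hes : eigenbasis As (theta_star P) es)
  (HAse : tridiagonal_action As (coef_up P) (coef_diag P) (coef_down P) e)
  (HAes : tridiagonal_action A (coef_up (dualp P)) (coef_diag (dualp P))
            (coef_down (dualp P)) es)
  (Hnorm : es`_0 = \sum_(M < (p2s P).+1) e`_M)
  (HOmL0 : OmL != 0)
  (HOmL : (OmL \o As)%VF = theta_star P 0 *: OmL)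
  (Hchi : chi != 0)
  (Halpha_minus :
     (pq P ^+ 2 - pq P ^- 2) * chi^-1 * alpha_minus * pb P * pq P ^ (- m0) = -1)
  (Halpha_plus :
     (pq P ^+ 2 - pq P ^- 2) * chi^-1 * alpha_plus * pcs P * pq P ^ m0 = 1)
  (Hbeta_plus :
     (pq P ^+ 2 - pq P ^- 2) * chi^-1 * beta_plus * pbs P * pq P ^ (- m0 + 2) = 1)
  (Hsol_minus : forall M : nat, (M <= p2s P)%N ->
     exists u : M.-tuple R[i], bethe_solution P false u)
  (Hsol_plus : forall N : nat, (N <= p2s P)%N ->
     exists w : N.-tuple R[i], bethe_solution P true w) :
  forall (M N : nat), (M <= p2s P)%N -> (N <= p2s P)%N ->
  forall (u : M.-tuple R[i]) (v : N.-tuple R[i]),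
  bethe_solution P false u -> bethe_solution P true v ->
  let ketM := Psi_minus P A As chi m0 alpha_minus u e`_0 in
  let ketN := Psi_plus P A As chi m0 alpha_plus v es`_0 in
  let braN := Psi_plus_left P A As chi m0 beta_plus v OmL in
  [/\ norm_star P v != 0, pairing OmL ketM != 0, pairing braN ketN != 0
    & qRacah P M N
      = (norm_star P v)^-1
        * (pairing braN ketM / pairing OmL ketM)
        * (pairing OmL es`_0 / pairing braN ketN)].
Proof.
move=> M N le_M le_N u v sol_u sol_v ketM ketN braN.
have L : leonard_system A As e by split.
have Ld : @leonard_system _ (invp P) _ As A es by apply: leonard_system_invp.
have am0 : alpha_minus != 0.
  apply: contra_eq_neq Halpha_minus => ->.
  by rewrite mulr0 !mul0r eq_sym oppr_eq0 oner_eq0.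
have bp0 : beta_plus != 0.
  by apply: contra_eq_neq Hbeta_plus => ->; rewrite mulr0 !mul0r eq_sym oner_eq0.
have [k k0 ketME] := Psi_minusE m0 L Hchi le_M am0 sol_u.
have [kb kb0 braNE] := Psi_plus_leftE m0 L Ld Hchi HOmL0 HOmL bp0 le_N sol_v Hsol_plus.
have ketNE := Psi_plusE chi m0 L Ld alpha_plus le_N sol_v.
rewrite (plus_scalarE L Ld Hchi v Halpha_plus) in ketNE.
have om0 := OmL_0_neq0 Ld HOmL0 HOmL.
have S0 := coord0_ket_neq0 L Ld HAes le_M; have S := coord_ket L Ld HAes le_M le_N.
have [es_basis _] := Hes.
have nz := norm_star_neq0 L Ld le_N sol_v.
(* The three products share the factors k, kb and the coordinate 0 of e_M; after cancellation only
   [norm_star] and [qRacah] remain. *)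
have braM : pairing braN ketM = kb * (k * (coord es 0 e`_M * qRacah P M N)).
  by rewrite /pairing /braN /ketM ketME braNE linearZ /= S.
have omM : pairing OmL ketM = OmL es`_0 * (k * coord es 0 e`_M).
  by rewrite /pairing /ketM ketME (OmLE Ld HOmL) linearZ.
have braNN : pairing braN ketN = kb * (norm_star P v)^-1.
  rewrite /pairing /braN /ketN ketNE braNE linearZ /= coord_tuple_nth //.
  by rewrite inordK // eqxx mulr1.
rewrite braM omM braNN; split=> //.
- by rewrite !mulf_neq0.
- by rewrite mulf_neq0 ?invr_eq0.
by rewrite /pairing; field; rewrite nz kb0 om0 k0 S0.
Qed.
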